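(* Let $N\ge0$ and $\lambda,\mu\in\mathrm{SP}(N)$. Let $\chi^\lambda_\alpha$ be the coefficients defined by the power-sum expansion $Q_\lambda=\sum_{\alpha\in\mathrm{OP}(N)}\frac{2^{\ell(\alpha)}}{z_\alpha}\chi_\alpha^\lambda p_\alpha$. Then $$C_{\lambda\mu}(t,s)=2^{-\ell(\mu)}\sum_{\alpha\in\mathrm{OP}(N)}\frac{2^{\ell(\alpha)}}{z_\alpha}\,\chi_\alpha^\lambda\,\chi_\alpha^\mu\,r_\alpha(t,s),\qquad r_\alpha(t,s)=\prod_{a\in\alpha}\frac{1-t^a}{1-s^a},$$ where the product runs over the parts of $\alpha$ with multiplicity.
   Context: A strict partition is a finite sequence $\lambda=(\lambda_1>\cdots>\lambda_\ell>0)$ of integers, with $|\lambda|=\sum\lambda_i$, $\ell(\lambda)=\ell$; $\mathrm{SP}(N)$ is the set of strict partitions of $N$ and $\mathrm{OP}(N)$ the set of partitions of $N$ with all parts odd. For $\alpha\in\mathrm{OP}(N)$, $\ell(\alpha)$ is its number of parts, $p_\alpha=\prod_ip_{\alpha_i}$, and $z_\alpha=\prod_{r\ge1}r^{m_r}m_r!$ with $m_r$ the multiplicity of $r$ in $\alpha$. Let $\Gamma=\mathbb{Q}[p_1,p_3,p_5,\ldots]$ be the ring of odd power sums, graded by $\deg p_n=n$, with degree-$N$ component $\Gamma_N$. The Schur $Q$-functions $Q_\lambda\in\Gamma$ are defined as follows: $q_r$ is given by $\sum_{r\ge0}q_rz^r=\exp\bigl(2\sum_{n\ge1,\ n\text{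 odd}}\frac{p_n}{n}z^n\bigr)$; for $r\ge s\ge0$ let $Q_{(r,s)}=q_rq_s+2\sum_{k=1}^{s}(-1)^kq_{r+k}q_{s-k}$; in general $Q_\lambda$ is the Pfaffian of the antisymmetric matrix with entries $Q_{(\lambda_i,\lambda_j)}$ for $i<j$, where a zero part is appended to $\lambda$ if $\ell(\lambda)$ is odd (so $Q_{(r)}=q_r$, $Q_\varnothing=1$). $\{Q_\lambda:\lambda\in\mathrm{SP}(N)\}$ is a basis of $\Gamma_N$. Standard fact from the classical theory of Schur $Q$-functions (Macdonald's book on symmetric functions): for the scalar product $\langle p_\alpha,p_\beta\rangle=2^{-\ell(\alpha)}z_\alpha\delta_{\alpha\beta}$ on $\Gamma$, $\langle Q_\lambda,Q_\mu\rangle=2^{\ell(\lambda)}\delta_{\lambda\mu}$. Let $t,s$ be independent indeterminates, with scalars extended to $\mathbb{Q}(t,s)$. Let $T_{t,s}$ be the algebra automorphism of $\Gamma$ (after extension of scalars) with $T_{t,s}(p_n)=\frac{1-t^n}{1-s^n}p_n$ for $n$ odd. Define $C_{\lambda\mu}(t,s)$, for $\lambda,\mu\in\mathrm{SP}(N)$, by $T_{t,s}Q_\lambda=\sum_{\mu\in\mathrm{SP}(N)}C_{\lambda\mu}(t,s)Q_\mu$. *)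

(* Defs.v *)
From HB Require Import structures.
From mathcomp Require Import all_boot all_order all_algebra all_fingroup finmap.
From mathcomp.multinomials Require Import monalg.

Set Implicit Arguments.
Unset Strict Implicit.
Unset Printing Implicit Defensive.

Import GRing.Theory.
Local Open Scope ring_scope.

Record part (N : nat) := Part {
  parts :> seq nat;
  partsP : [&& sorted geq parts, 0%N \notin parts & sumn parts == N] }.

HB.instance Definition _ N := [isSub for @parts N].
HB.instance Definition _ N := [Countable of part N by <:].

Section PartFinite.
Variable N : nat.

Lemma part_size_le (l : part N) : (size l <= N)%N.
Proof.
case: l => s /=/and3P[_ s0 /eqP <-].
elim: s s0 => //= a s IH; rewrite inE negb_or => /andP[a0 /IH s_le].
by rewrite -add1n leq_add // lt0n eq_sym.
Qed.

Lemma part_mem_le (l : part N) a : a \in parts l -> (a < N.+1)%N.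
Proof.
case: l => s /= /and3P[_ _ /eqP <-]; rewrite ltnS.
elim: s => //= b s IH; rewrite inE => /predU1P[->|/IH a_le].
  exact: leq_addr.
exact: leq_trans a_le (leq_addl _ _).
Qed.

Definition part_code (l : part N) : N.-bseq 'I_N.+1 :=
  insub_bseq N [seq inord a | a <- parts l].

Definition part_decode (b : N.-bseq 'I_N.+1) : option (part N) :=
  insub [seq val i | i <- b].

Lemma part_codeK : pcancel part_code part_decode.
Proof.
move=> l; rewrite /part_decode /part_code /insub_bseq.
have sz : (size [seq inord a : 'I_N.+1 | a <- parts l] <= N)%N.
  by rewrite size_map part_size_le.
rewrite insubdK // -map_comp (_ : map _ _ = parts l) ?valK //.
by apply: map_id_in => a /part_mem_le a_lt /=; rewrite inordK.
Qed.

HB.instance Definition _ := isFinite.Build (part N) (pcan_enumP part_codeK).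

End PartFinite.

Definition SP (N : nat) : {set part N} := [set l | sorted gtn (parts l)].
Definition OP (N : nat) : {set part N} := [set l | all odd (parts l)].

Definition zpart (al : seq nat) : nat :=
  (\prod_(r <- undup al) (r ^ count_mem r al * (count_mem r al)`!))%N.

(* Polynomials in variables indexed by nat: the variable of index k stands *)
(* for p_(2k+1).                                                           *)
Notation Gamma R := {malg R[{cmonom nat}]}.

(* Meaningful for odd n only: p_n is the variable of index n./2.           *)
Definition psum (R : comNzRingType) (n : nat) : Gamma R :=
  mkmalgU (ucm n./2) 1.

Definition ppart (R : comNzRingType) (al : seq nat) : Gamma R :=
  \prod_(a <- al) psum R a.

(* The substitution sending the variable of index k to v k and acting by f *)
(* on the coefficients.                                                    *)
Section Substitution.
Variables (R S : comNzRingType) (f : {rmorphism R -> S}) (v : nat -> S).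

Definition meval (m : {cmonom nat}) : S := \prod_(k <- finsupp m) v k ^+ m k.
Definition gsubst (g : Gamma R) : S := mmap f meval g.

Lemma mevalEw (E : {fset nat}) (m : {cmonom nat}) :
  (finsupp m `<=` E)%fset -> meval m = \prod_(k <- E) v k ^+ m k.
Proof.
move=> le; rewrite /meval (big_fset_incl _ le) // => k _ /fsfun_dflt.
by move=> ->; rewrite expr0.
Qed.

Lemma meval_mmorphism : mmorphism meval.
Proof.
split=> [m1 m2|]; last by rewrite /meval mdom1 big_nil.
rewrite (@mevalEw (finsupp m1 `|` finsupp m2)%fset) ?mdomD //.
rewrite (mevalEw (fsubsetUl _ (finsupp m2))).
rewrite (mevalEw (fsubsetUr (finsupp m1) _)) -big_split /=.
by apply: eq_bigr => k _; rewrite cmM exprD.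
Qed.

HB.instance Definition _ := isMultiplicative.Build _ _ meval meval_mmorphism.
HB.instance Definition _ := GRing.RMorphism.copy gsubst (mmap f meval).

Lemma gsubst_psum n : gsubst (psum R n) = v n./2.
Proof.
rewrite /gsubst /psum mmapU [X in X * _](rmorph1 f) mul1r /meval mdomU.
by rewrite big_seq_fset1 cmUU expr1.
Qed.
End Substitution.

(* The terms of 2 * sum_n p_n / n z^n of degree at most r in z.            *)
Definition qlog (r : nat) : {poly Gamma rat} :=
  \sum_(n < r.+1 | odd n) (2 / (n : nat)%:R *: psum rat n) *: 'X^n.

(* The coefficient of z^r in the exponential: since the exponent has no    *)
(* constant term, neither its terms of degree above r nor its powers of    *)
(* exponent above r contribute.                                            *)
Definition qfun (r : nat) : Gamma rat :=
  \sum_(k < r.+1) ((k`!)%:R^-1 : rat) *: (qlog r ^+ k)`_r.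

(* For r >= s.                                                             *)
Definition qfun2 (r s : nat) : Gamma rat :=
  qfun r * qfun s
  + 2 * \sum_(1 <= k < s.+1) (-1) ^+ k * qfun (r + k) * qfun (s - k).

Section Pfaffian.
Variable m : nat.

Lemma ord_even_subproof (i : 'I_m) : (i.*2 < m.*2)%N.
Proof. by rewrite ltn_double. Qed.

Lemma ord_odd_subproof (i : 'I_m) : (i.*2.+1 < m.*2)%N.
Proof. by rewrite ltn_Sdouble. Qed.

Definition ord_even (i : 'I_m) : 'I_m.*2 := Ordinal (ord_even_subproof i).
Definition ord_odd (i : 'I_m) : 'I_m.*2 := Ordinal (ord_odd_subproof i).

Definition pfaffian (A : 'M[Gamma rat]_(m.*2)) : Gamma rat :=
  ((2 ^ m * m`!)%N%:R^-1 : rat) *: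
    \sum_(sg : 'S_(m.*2))
      (-1) ^+ sg * \prod_(i < m) A (sg (ord_even i)) (sg (ord_odd i)).

End Pfaffian.

(* The size of the matrix is size lam, rounded up to an even number; the   *)
(* default value of nth supplies the zero part appended when size lam is   *)
(* odd.                                                                    *)
Definition schurQ (lam : seq nat) : Gamma rat :=
  pfaffian (\matrix_(i < (uphalf (size lam)).*2, j < (uphalf (size lam)).*2)
    if (i < j)%N then qfun2 (nth 0%N lam i) (nth 0%N lam j)
    else if (j < i)%N then - qfun2 (nth 0%N lam j) (nth 0%N lam i)
    else 0).

Definition Qts : fieldType := {fraction {poly {poly rat}}}.
Definition tvar : Qts := tofrac ('X%:P).
Definition svar : Qts := tofrac 'X.

Definition ratQts : {rmorphism rat -> Qts} :=
  @tofrac {poly {poly rat}} \o (polyC \o polyC).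

Definition ext_scalars : Gamma rat -> Gamma Qts :=
  gsubst (malgC \o ratQts) (fun k => psum Qts k.*2.+1).

Definition rfactor (n : nat) : Qts := (1 - tvar ^+ n) / (1 - svar ^+ n).

Definition Tts : Gamma Qts -> Gamma Qts :=
  gsubst malgC (fun k => rfactor k.*2.+1 *: psum Qts k.*2.+1).

HB.instance Definition _ := GRing.RMorphism.copy ext_scalars
  (gsubst (malgC \o ratQts) (fun k => psum Qts k.*2.+1)).
HB.instance Definition _ := GRing.RMorphism.copy Tts
  (gsubst malgC (fun k => rfactor k.*2.+1 *: psum Qts k.*2.+1)).

Lemma odd_half_doubleS n : odd n -> n./2.*2.+1 = n.
Proof. by move=> n_odd; rewrite -[RHS]odd_double_half n_odd. Qed.

Lemma ext_scalars_psum n : odd n -> ext_scalars (psum rat n) = psum Qts n.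
Proof. by move=> n_odd; rewrite /ext_scalars gsubst_psum odd_half_doubleS. Qed.

Lemma Tts_psum n : odd n -> Tts (psum Qts n) = rfactor n *: psum Qts n.
Proof. by move=> n_odd; rewrite /Tts gsubst_psum odd_half_doubleS. Qed.

Definition rpart (al : seq nat) : Qts := \prod_(a <- al) rfactor a.

(* Main.v *)
(* Write Q_lambda through the antisymmetric form A(a, b) = Q_(a,b) on the
   indices 0, 1, 2, ... and a formal index oo (the zero part completing a
   partition of odd length), with A(a, oo) = q_a and A(0, oo) = 1, and let
   <p_alpha, p_beta> = 2^(-l(alpha)) z_alpha delta. The adjoint of the
   multiplication by q_r is the coefficient of z^r in the ring morphism
   D : p_n |-> p_n + z^n, and the Euler relation
   r q_r = 2 sum_(n odd) p_n q_(r-n) shows that D transforms each index of A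
   linearly: e_a |-> sum_i f_i z^i e_(a-i) with f_0 = 1 and f_i = 2 otherwise.
   Subtracting from each row of the Pfaffian of D Q_lambda the next one times
   z^(lambda_i - lambda_(i+1)) leaves rows of degree lambda_i - lambda_(i+1)
   with leading term e_(lambda_(i+1)). Hence the coefficient of z^r in
   D Q_lambda is 0 for r > lambda_1, and 2 Q_(lambda_2, lambda_3, ...) for
   r = lambda_1. On the other hand, linearity in the first row gives
   Q_mu = q_(mu_1) Q_(mu_2, mu_3, ...) + sum_(r > mu_1) q_r X_r.
   These two facts yield <Q_lambda, Q_mu> = 2^l(lambda) delta by induction on
   the lengths, and the theorem follows by comparing coefficients of the
   p_alpha in T Q_lambda = sum_nu C_(lambda nu) Q_nu. *)
From HB Require Import structures.
Require Import Defs.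
From mathcomp Require Import all_boot all_order all_algebra all_fingroup finmap.
From mathcomp.multinomials Require Import monalg.
From mathcomp Require Import ring zify.

Set Implicit Arguments.
Unset Strict Implicit.
Unset Printing Implicit Defensive.

Import GRing.Theory Num.Theory.
Local Open Scope ring_scope.

(** * Pfaffian sums *)

Section OrdPairs.
Variable m : nat.

Definition ord_half (k : 'I_m.*2) : 'I_m :=
  Ordinal (eq_ind_r is_true (ltn_ord k) (ltn_half_double k m)).

Lemma ord_halfK_even (k : 'I_m.*2) : ~~ odd k -> ord_even (ord_half k) = k.
Proof.
move=> k_even; apply: val_inj => /=.
by rewrite -[RHS]odd_double_half (negPf k_even).
Qed.

Lemma ord_halfK_odd (k : 'I_m.*2) : odd k -> ord_odd (ord_half k) = k.
Proof.
by move=> k_odd; apply: val_inj; rewrite /= -[RHS]odd_double_half k_odd.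
Qed.

Lemma ord_evenK : cancel (@ord_even m) ord_half.
Proof. by move=> i; apply: val_inj; rewrite /= doubleK. Qed.

Lemma ord_oddK : cancel (@ord_odd m) ord_half.
Proof. by move=> i; apply: val_inj; rewrite /= uphalf_double. Qed.

Lemma big_ord_pairs (R : Type) (idx : R) (op : Monoid.com_law idx) F :
  \big[op/idx]_(k < m.*2) F k =
    \big[op/idx]_(i < m) op (F (ord_even i)) (F (ord_odd i)).
Proof.
rewrite (bigID (fun k : 'I_m.*2 => odd k)) /= Monoid.mulmC big_split /=.
congr (op _ _).
  rewrite (reindex (@ord_even m)) /=; last first.
    by exists ord_half => k; rewrite inE => ?; [exact: ord_evenK|exact: ord_halfK_even].
  by apply: eq_bigl => i; rewrite /= odd_double.
rewrite (reindex (@ord_odd m)) /=; last first.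
  by exists ord_half => k; rewrite inE => ?; [exact: ord_oddK|exact: ord_halfK_odd].
by apply: eq_bigl => i; rewrite /= odd_double.
Qed.

(** The two summation indices of the factor [i] become the values of one function at [ord_even i]
    and [ord_odd i], a shape that allows the argument for products of determinants. *)
Lemma prod_pair_sum (R : comNzRingType) (J : finType) (X : 'I_m -> J -> J -> R) :
  \prod_(i < m) \sum_a \sum_b X i a b =
    \sum_(f : {ffun 'I_m.*2 -> J})
      \prod_(i < m) X i (f (ord_even i)) (f (ord_odd i)).
Proof.
transitivity (\prod_(i < m) \sum_(p : J * J) X i p.1 p.2).
  by apply: eq_bigr => i _; rewrite pair_bigA.
rewrite bigA_distr_bigA.
pose to_pairs (f : {ffun 'I_m.*2 -> J}) : {ffun 'I_m -> J * J} :=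
  [ffun i => (f (ord_even i), f (ord_odd i))].
rewrite (reindex to_pairs) /=; last first.
  exists (fun g : {ffun 'I_m -> J * J} => [ffun k : 'I_m.*2 =>
    if odd k then (g (ord_half k)).2 else (g (ord_half k)).1]) => [f|g] _.
    apply/ffunP=> k; rewrite !ffunE.
    by case: ifPn => [/ord_halfK_odd|/ord_halfK_even] /= ->.
  apply/ffunP=> i; rewrite !ffunE /= odd_double /=.
  by rewrite ord_evenK ord_oddK; case: (g i).
by apply: eq_bigr => f _; apply: eq_bigr => i _; rewrite ffunE.
Qed.

End OrdPairs.

Lemma big_lift_perm (R : Type) (idx : R) (op : Monoid.com_law idx) n
    (i j : 'I_n.+1) (F : 'S_n.+1 -> R) :
  \big[op/idx]_(s : 'S_n.+1 | s i == j) F s =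
    \big[op/idx]_(s : 'S_n) F (lift_perm i j s).
Proof.
(* The inverse of [lift_perm i j] deletes [i] and its image; as [s] is injective, [unlift] succeeds
   and the default [k] is never returned. *)
have lower_inj (s : 'S_n.+1) : injective (fun k =>
    odflt k (unlift (s i) (s (lift i k)))).
  move=> k l; have ne k' : s i != s (lift i k').
    by rewrite (inj_eq perm_inj) neq_lift.
  case/unlift_some: (ne k) (ne l) => k' ek -> /unlift_some[l' el ->] /= kl.
  by apply: (@lift_inj _ i); apply: (@perm_inj _ s); rewrite ek el kl.
rewrite (reindex (lift_perm i j)) /=; last first.
  exists (fun s => perm (lower_inj s)) => [s _|s].
    by apply/permP=> k; rewrite permE lift_perm_lift lift_perm_id liftK.
  rewrite inE => /eqP si; apply/permP=> k.
  case: (unliftP i k) => [k'|] ->; last by rewrite lift_perm_id si.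
  rewrite lift_perm_lift permE; have : s i != s (lift i k').
    by rewrite (inj_eq perm_inj) neq_lift.
  by case/unlift_some=> l el ->; rewrite el si.
by apply: eq_bigl => s; rewrite lift_perm_id eqxx.
Qed.

Section PfaffianSum.
Variable R : comNzRingType.

(* The Pfaffian before division by 2 ^ m * m`!. *)
Definition pfsum m (A : 'M[R]_(m.*2)) : R :=
  \sum_(sg : 'S_(m.*2))
    (-1) ^+ sg * \prod_(i < m) A (sg (ord_even i)) (sg (ord_odd i)).

(** As for the multiplicativity of determinants: once the entries are expanded, a non-injective
    choice [f] of inner indices contributes a determinant with two equal rows, and an injective one
    is a permutation that is absorbed into [s]. *)
Lemma pfsum_congr m (P A : 'M[R]_(m.*2)) :
  pfsum (P *m A *m P^T) = \det P * pfsum A.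
Proof.
rewrite -det_tr /pfsum.
pose PA (s : 'S_(m.*2)) (i : 'I_m) a b :=
  P (s (ord_even i)) a * P (s (ord_odd i)) b * A a b.
transitivity (\sum_(f : {ffun 'I_m.*2 -> 'I_m.*2}) \sum_(s : 'S_(m.*2))
   (-1) ^+ s * \prod_(i < m) PA s i (f (ord_even i)) (f (ord_odd i))).
  rewrite exchange_big; apply: eq_bigr => /= s _; rewrite -big_distrr /=.
  congr (_ * _); rewrite -(prod_pair_sum (PA s)) /=.
  apply: eq_bigr => i _; rewrite mxE exchange_big /=; apply: eq_bigr => b _.
  rewrite !mxE big_distrl /=; apply: eq_bigr => a _.
  by rewrite /PA mulrAC.
have PAE s (f : 'I_m.*2 -> 'I_m.*2) :
    \prod_(i < m) PA s i (f (ord_even i)) (f (ord_odd i)) =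
    \prod_k P^T (f k) (s k) * \prod_(i < m) A (f (ord_even i)) (f (ord_odd i)).
  rewrite big_ord_pairs -big_split /=; apply: eq_bigr => i _.
  by rewrite !mxE.
rewrite (bigID (fun f : {ffun _ -> _} => injectiveb f)) /= addrC.
rewrite big1 ?add0r => [|f Uf].
  rewrite (reindex (@pval _)) /=; last first.
    pose in_Sn := insubd (1%g : 'S_(m.*2)).
    by exists in_Sn => /= f Uf; first apply: val_inj; apply: insubdK.
  rewrite big_distrr /=; apply: eq_big => /= [s | s _]; rewrite ?(valP s) //.
  rewrite big_distrl /=.
  rewrite (reindex_inj (mulgI s)); apply: eq_bigr => t _ /=.
  rewrite PAE !pvalE odd_permM signr_addb -!mulrA mulrCA; congr (_ * _).
  rewrite [in RHS]mulrCA; congr (_ * (_ * _)).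
  rewrite [RHS](reindex_perm s) /=; apply: eq_bigr => k _.
  by rewrite permM.
transitivity (\det (\matrix_(i, j) P^T (f i) j) *
   \prod_(i < m) A (f (ord_even i)) (f (ord_odd i))).
  rewrite big_distrl /=; apply: eq_bigr => s _.
  rewrite PAE mulrA; congr (_ * _ * _).
  by apply: eq_bigr => x _; rewrite !mxE.
case/injectivePn: Uf => i1 [i2 Di12 Ef12].
by rewrite (determinant_alternate Di12) ?mul0r //= => j; rewrite !mxE Ef12.
Qed.

Lemma pfsum_perm m (s : 'S_(m.*2)) (A : 'M[R]_(m.*2)) :
  pfsum (\matrix_(i, j) A (s i) (s j)) = (-1) ^+ s * pfsum A.
Proof.
rewrite -det_perm -pfsum_congr; congr pfsum; apply/matrixP=> i j.
by rewrite -row_permE tr_perm_mx -col_permE !mxE.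
Qed.

(* The entry (i0, i0) plays no role. *)
Definition set_cross n (i0 : 'I_n) (v : 'I_n -> R) (A : 'M[R]_n) : 'M[R]_n :=
  \matrix_(i, j) if i == i0 then v j else if j == i0 then - v i else A i j.

(** No pair consists of an index and itself, so the new row is never read at [i0]. *)
Lemma pfsum_cross_eq m i0 v w (A : 'M[R]_(m.*2)) :
  (forall j, j != i0 -> v j = w j) ->
  pfsum (set_cross i0 v A) = pfsum (set_cross i0 w A).
Proof.
move=> vw; apply: eq_bigr => s _; congr (_ * _); apply: eq_bigr => i _.
have neq : s (ord_even i) != s (ord_odd i).
  by rewrite (inj_eq perm_inj) -val_eqE /= neq_ltn ltnSn.
rewrite !mxE; case: eqP => [e|_]; first by rewrite vw // -e eq_sym.
by case: eqP => // e; rewrite vw // -e.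
Qed.

Lemma pfsum_cross_sum m i0 (J : finType) (c : J -> R) v (A : 'M[R]_(m.*2)) :
  pfsum (set_cross i0 (fun j => \sum_r c r * v r j) A) =
    \sum_r c r * pfsum (set_cross i0 (v r) A).
Proof.
under [RHS]eq_bigr => r _ do rewrite big_distrr /=.
rewrite exchange_big; apply: eq_bigr => s _ /=.
under [RHS]eq_bigr => r _ do rewrite mulrCA.
rewrite -big_distrr /=; congr (_ * _).
(* [h] is the pair that [s] maps onto [i0] and its partner; it gives the only factor that meets the
   replaced row or column, hence linearity. *)
pose h := ord_half (s^-1%g i0).
have neq i : s (ord_even i) != s (ord_odd i).
  by rewrite (inj_eq perm_inj) -val_eqE /= neq_ltn ltnSn.
have h_in : (s (ord_even h) == i0) || (s (ord_odd h) == i0).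
  have [h_odd|h_even] := boolP (odd (s^-1%g i0)).
    by rewrite /h ord_halfK_odd // permKV eqxx orbT.
  by rewrite /h ord_halfK_even // permKV eqxx.
have notin i : i != h -> (s (ord_even i) == i0) = false /\ (s (ord_odd i) == i0) = false.
  move=> ih; split; apply: contra_neqF ih => /eqP e; rewrite /h -e permK.
    by rewrite ord_evenK.
  by rewrite ord_oddK.
rewrite (bigD1 h) //=.
under [RHS]eq_bigr => r _ do rewrite (bigD1 h) //= mulrA.
pose rest := \prod_(i < m | i != h) A (s (ord_even i)) (s (ord_odd i)).
have restE v' : \prod_(i < m | i != h)
    set_cross i0 v' A (s (ord_even i)) (s (ord_odd i)) = rest.
  by apply: eq_bigr => i /notin[e1 e2]; rewrite mxE e1 e2.
rewrite restE; under [RHS]eq_bigr => r _ do rewrite restE.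
rewrite -big_distrl /=; congr (_ * _); rewrite !mxE.
have [e1|e1] := boolP (s (ord_even h) == i0).
  by rewrite /=; apply: eq_bigr => r _; rewrite mxE e1.
move: h_in; rewrite (negPf e1) /= => e2; rewrite e2 -sumrN.
by apply: eq_bigr => r _; rewrite mxE (negPf e1) e2 mulrN.
Qed.

Lemma pfsum_swap m (A : 'M[R]_(m.*2)) (i j : 'I_(m.*2)) : i != j ->
  pfsum (\matrix_(a, b) A (tperm i j a) (tperm i j b)) = - pfsum A.
Proof. by move=> ij; rewrite pfsum_perm odd_tperm ij mulN1r. Qed.

(** The swap both fixes and negates the sum; over a general ring this makes only its double
    vanish. *)
Lemma pfsum_repeat m (A : 'M[R]_(m.*2)) (i j : 'I_(m.*2)) : i != j ->
  (forall a b, A (tperm i j a) (tperm i j b) = A a b) -> pfsum A *+ 2 = 0.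
Proof.
move=> ij rep; apply/eqP; rewrite mulr2n addr_eq0 -(pfsum_swap A ij).
by apply/eqP; congr pfsum; apply/matrixP=> a b; rewrite mxE rep.
Qed.

Section Peel.
Variables (m : nat) (A : 'M[R]_(m.+1.*2)).
Hypothesis A_anti : forall i j, A i j = - A j i.

Let term (s : 'S_(m.+1.*2)) : R :=
  (-1) ^+ s * \prod_(i < m.+1) A (s (ord_even i)) (s (ord_odd i)).

Let termJ_odd s i : term (tperm (ord_even i) (ord_odd i) * s)%g = term s.
Proof.
have neq : @ord_even m.+1 i != ord_odd i by rewrite -val_eqE /= neq_ltn ltnSn.
rewrite /term odd_permM odd_tperm neq signr_addb mulN1r mulNr -mulrN.
congr (_ * _); rewrite (bigD1 i) //= [in RHS](bigD1 i) //= -mulNr !permM.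
rewrite tpermL tpermR -A_anti; congr (_ * _); apply: eq_bigr => j ji.
have ne b (c : 'I_m.+1.*2) : ord_half c = i -> ord_half b = j -> c != b.
  by move=> ci bj; apply: contraNneq ji => cb; rewrite -ci -bj cb.
by rewrite !permM !tpermD // ne // ?ord_evenK ?ord_oddK.
Qed.

Let termJ_pair s i j :
  term (tperm (ord_even i) (ord_even j) * tperm (ord_odd i) (ord_odd j) * s)%g
  = term s.
Proof.
have [->|ij] := eqVneq i j; first by rewrite !tperm1 !mul1g.
have ne_even : @ord_even m.+1 i != ord_even j.
  by rewrite (can_eq (@ord_evenK _)).
have ne_odd : @ord_odd m.+1 i != ord_odd j by rewrite (can_eq (@ord_oddK _)).
rewrite /term !odd_permM !odd_tperm ne_even /=.
congr (_ * _); rewrite [RHS](reindex_perm (tperm i j)); apply: eq_bigr => k _.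
have ne (a b : 'I_m.+1) : @ord_even m.+1 a != ord_odd b.
  by rewrite -val_eqE /=; apply/eqP=> /(congr1 odd) /=; rewrite !odd_double.
have t_even : tperm (ord_even i) (ord_even j) (ord_even k) = ord_even (tperm i j k).
  by rewrite inj_tperm //; apply: can_inj (@ord_evenK _).
have t_odd : tperm (ord_odd i) (ord_odd j) (ord_odd k) = ord_odd (tperm i j k).
  by rewrite inj_tperm //; apply: can_inj (@ord_oddK _).
rewrite !permM t_even [tperm (ord_even i) _ (ord_odd k)]tpermD ?t_odd ?ne //.
by rewrite [tperm (ord_odd i) _ _]tpermD // eq_sym ne.
Qed.

Let drop2 (i : 'I_m.*2) : 'I_m.+1.*2 :=
  lift (ord_max : 'I_m.*2.+2) (lift (ord_max : 'I_m.*2.+1) i).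

(** Expansion along the next-to-last row, whose only entry that counts is the 1 in the last
    column. *)
Lemma pfsum_peel :
  (forall k : 'I_m.+1.*2, k != ord_odd ord_max ->
    A (ord_even ord_max) k = 0) ->
  A (ord_even ord_max) (ord_odd ord_max) = 1 ->
  pfsum A = (m.+1.*2)%:R * pfsum (\matrix_(i, j) A (drop2 i) (drop2 j)).
Proof.
move=> A0 A1.
pose r : 'I_m.+1.*2 := ord_even ord_max.
pose r' : 'I_m.+1.*2 := ord_odd ord_max.
have sum_r c : \sum_(s : 'S_(m.+1.*2) | s c == r) term s =
    \sum_(s : 'S_(m.+1.*2) | s r == r) term s.
  have sum_even i : \sum_(s : 'S_(m.+1.*2) | s (ord_even i) == r) term s =
    \sum_(s : 'S_(m.+1.*2) | s r == r) term s.
    pose t := (tperm (ord_even i) r * tperm (ord_odd i) r')%g.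
    rewrite (reindex_inj (mulgI t)) /=; apply: eq_big => [s|s _]; last first.
      exact: termJ_pair.
    rewrite !permM tpermL tpermD // -val_eqE /=; apply/eqP=> /(congr1 odd) /=;
      by rewrite !odd_double.
  have [c_odd|c_even] := boolP (odd c); last first.
    by rewrite -(ord_halfK_even c_even) sum_even.
  rewrite -(ord_halfK_odd c_odd) -(sum_even (ord_half c)).
  rewrite (reindex_inj (mulgI (tperm (ord_even (ord_half c)) (ord_odd (ord_half c))))) /=.
  by apply: eq_big => [s|s _]; [rewrite permM tpermR|rewrite termJ_odd].
(* The permutations are sorted by the position [c] at which they take the value [r]. Exchanging
   pairs, or the members of a pair, shows that all positions contribute equally, whence the factor
   [m.+1.*2]. *)
transitivity (\sum_(c : 'I_m.+1.*2) \sum_(s : 'S_(m.+1.*2) | s c == r) term s).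
  rewrite (exchange_big_dep xpredT) //=; apply: eq_bigr => s _.
  rewrite (bigD1 (s^-1%g r)) ?permKV //= [X in _ + X]big1 ?addr0 // => c /andP[/eqP <-].
  by rewrite permK eqxx.
under eq_bigr => c _ do rewrite sum_r.
rewrite sumr_const card_ord -[LHS]mulr_natl; congr (_ * _).
have r'E : r' = ord_max :> 'I_m.*2.+2 by apply: val_inj.
have rE : r = lift (ord_max : 'I_m.*2.+2) (ord_max : 'I_m.*2.+1).
  by apply: val_inj; rewrite /= /bump ltnn.
rewrite (bigID (fun s : 'S_(m.+1.*2) => s r' == r')) /= [X in _ + X]big1 ?addr0.
  under eq_bigl => s do rewrite andbC.
  rewrite big_mkcondr /= r'E (big_lift_perm _ (ord_max : 'I_m.*2.+2)) /=.
  rewrite -big_mkcond rE.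
  under eq_bigl => s do rewrite lift_perm_lift (inj_eq lift_inj).
  rewrite (big_lift_perm _ (ord_max : 'I_m.*2.+1)); apply: eq_bigr => s _.
  rewrite /term !odd_lift_perm !addbb /=; congr (_ * _).
  rewrite big_ord_recr /=.
  have -> : ord_even ord_max = lift (ord_max : 'I_m.*2.+2) (ord_max : 'I_m.*2.+1).
    exact: rE.
  have -> : ord_odd ord_max = (ord_max : 'I_m.*2.+2) by exact: r'E.
  rewrite lift_perm_lift !lift_perm_id -rE -r'E A1 mulr1; apply: eq_bigr => i _.
  have dE (k : 'I_m.*2) (k' : 'I_m.+1.*2) : val k' = val k -> k' = drop2 k.
    move=> e; apply: val_inj; rewrite e /= /bump.
    have k_lt := ltn_ord k.
    by rewrite [(m.*2 <= k)%N]leqNgt k_lt add0n ltnNge ltnW.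
  rewrite (dE (ord_even i) (ord_even (widen_ord (leqnSn m) i))) //.
  rewrite (dE (ord_odd i) (ord_odd (widen_ord (leqnSn m) i))) // mxE /drop2.
  by rewrite !lift_perm_lift.
move=> s /andP[/eqP sr sr']; rewrite /term big_ord_recr /= -/r -/r' sr A0 ?mulr0 //.
Qed.
End Peel.

End PfaffianSum.

Lemma rmorph_pfsum (R S : comNzRingType) (f : {rmorphism R -> S}) m
    (A : 'M[R]_(m.*2)) : f (pfsum A) = pfsum (map_mx f A).
Proof.
rewrite rmorph_sum; apply: eq_bigr => s _.
rewrite rmorphM rmorph_sign rmorph_prod; congr (_ * _).
by apply: eq_bigr => i _; rewrite mxE.
Qed.

(** * Top-degree coefficients of Pfaffian sums *)

Section TopCoef.
Variable R : comNzRingType.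
Implicit Types p q : {poly R}.

Lemma coefM_top p q a b : (size p <= a.+1)%N -> (size q <= b.+1)%N ->
  (size (p * q)%R <= (a + b).+1)%N /\ (p * q)`_(a + b) = p`_a * q`_b.
Proof.
move=> pa qb; split.
  apply: leq_trans (size_polyMleq p q) _.
  by rewrite -subn1 leq_subLR add1n -addnS -addSn leq_add.
have a_lt : (a < (a + b).+1)%N by rewrite ltnS leq_addr.
rewrite coefM (bigD1 (Ordinal a_lt)) //= addKn big1 ?addr0 // => i.
rewrite -val_eqE /= neq_ltn => /orP[lt_ia|lt_ai].
  rewrite [q`__]nth_default ?mulr0 //; apply: leq_trans qb _.
  by rewrite ltn_subRL ltn_add2r.
by rewrite [p`__]nth_default ?mul0r //; apply: leq_trans pa _.
Qed.

Lemma coef_prod_top (I : Type) (r : seq I) (p : I -> {poly R}) (d : I -> nat) :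
  (forall i, size (p i) <= (d i).+1)%N ->
  (size (\prod_(i <- r) p i)%R <= (\sum_(i <- r) d i).+1)%N /\
  (\prod_(i <- r) p i)`_(\sum_(i <- r) d i)%N = \prod_(i <- r) (p i)`_(d i).
Proof.
move=> pd; elim: r => [|i r [IHs IHc]].
  by rewrite !big_nil coef1 size_poly1.
by rewrite !big_cons; have [? ->] := coefM_top (pd i) IHs; rewrite IHc.
Qed.

(** A permutation uses every index once, so each of its terms has degree at most the sum of all
    [d i], whatever the permutation. *)
Lemma coef_pfsum_top m (A : 'M[{poly R}]_(m.*2)) (d : 'I_m.*2 -> nat) :
  (forall i j, size (A i j) <= (d i + d j).+1)%N ->
  (size (pfsum A) <= (\sum_i d i).+1)%N /\
  (pfsum A)`_(\sum_i d i)%N = pfsum (\matrix_(i, j) (A i j)`_(d i + d j)).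
Proof.
move=> Ad.
have term_top (s : 'S_(m.*2)) := @coef_prod_top _ (index_enum 'I_m)
  (fun i => A (s (ord_even i)) (s (ord_odd i)))
  (fun i => (d (s (ord_even i)) + d (s (ord_odd i)))%N) (fun i => Ad _ _).
have sumE (s : 'S_(m.*2)) : (\sum_(i < m)
    (d (s (ord_even i)) + d (s (ord_odd i))))%N = (\sum_i d i)%N.
  by rewrite [RHS](reindex_perm s) big_ord_pairs.
split.
  apply: leq_trans (size_sum _ _ _) _; apply/bigmax_leqP => s _.
  by rewrite -(sumE s) mulr_sign; case: ifP; rewrite ?size_polyN; have [] := term_top s.
rewrite coef_sum; apply: eq_bigr => s _; have [_ topE] := term_top s.
rewrite -(sumE s) -(rmorph_sign (@polyC R)) coefCM topE; congr (_ * _).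
by apply: eq_bigr => i _; rewrite mxE.
Qed.

End TopCoef.

(** * Generating functions of exponential type *)

Section Convolution.
Variable S : comNzRingType.
Implicit Types a b c : nat -> S.

Definition conv a b r : S := \sum_(i < r.+1) a i * b (r - i)%N.

Lemma convE a b r M : (r <= M)%N ->
  conv a b r = (\poly_(i < M.+1) a i * \poly_(i < M.+1) b i)`_r.
Proof.
move=> rM; rewrite coefM; apply: eq_bigr => i _; rewrite !coef_poly !ltnS.
have ir : (i <= r)%N by rewrite -ltnS.
by rewrite (leq_trans ir rM) (leq_trans (leq_subr i r) rM).
Qed.

Lemma eq_conv a a' b b' : a =1 a' -> b =1 b' -> conv a b =1 conv a' b'.
Proof. by move=> aa bb r; apply: eq_bigr => i _; rewrite aa bb. Qed.

Lemma convC a b : conv a b =1 conv b a.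
Proof. by move=> r; rewrite !(convE _ _ (leqnn r)) mulrC. Qed.

Lemma convA a b c : conv a (conv b c) =1 conv (conv a b) c.
Proof.
move=> r; rewrite !(convE _ _ (leqnn r)).
pose p x := \poly_(i < r.+1) x i : {poly S}.
transitivity ((p a * (p b * p c))`_r).
  rewrite !coefM; apply: eq_bigr => i _; rewrite [X in _ * X]coef_poly ltnS leq_subr.
  by rewrite (convE _ _ (leq_subr i r)).
rewrite mulrA [LHS]coefM [RHS]coefM; apply: eq_bigr => i _.
have ir : (i <= r)%N by rewrite -ltnS.
by rewrite [X in _ = X * _]coef_poly ltn_ord (convE _ _ ir).
Qed.

Lemma convDl a a' b r :
  conv (fun i => a i + a' i) b r = conv a b r + conv a' b r.
Proof.
by rewrite /conv -big_split /=; apply: eq_bigr => i _; rewrite mulrDl.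
Qed.

Lemma conv_euler a b r : r%:R * conv a b r =
  conv (fun i => i%:R * a i) b r + conv a (fun i => i%:R * b i) r.
Proof.
rewrite /conv -big_split big_distrr /=; apply: eq_bigr => i _.
have ir : (i <= r)%N by rewrite -ltnS.
have -> : r%:R = i%:R + (r - i)%:R :> S by rewrite -natrD subnKC.
by rewrite mulrDl mulrA [in X in _ + X]mulrCA.
Qed.

(** For generating series the hypothesis on [a] reads z a' = P a, and logarithmic derivatives add
    under multiplication. *)
Lemma convM_euler P Q a b : (forall r, r%:R * a r = conv P a r) ->
    (forall r, r%:R * b r = conv Q b r) ->
  forall r, r%:R * conv a b r = conv (fun i => P i + Q i) (conv a b) r.
Proof.
move=> aE bE r; rewrite conv_euler convDl !convA; congr (_ + _).
  exact: eq_conv.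
rewrite (eq_conv (fun=> erefl) bE) convA.
by apply: eq_conv => // i; rewrite convC.
Qed.

(** As P has no constant term, the equation expresses [r%:R * a r] by earlier values, and [r%:R] can
    be cancelled for positive [r]. *)
Lemma conv_euler_uniq P a b : (forall r : nat, @GRing.lreg S r.+1%:R) ->
    P 0%N = 0 -> a 0%N = b 0%N ->
    (forall r, r%:R * a r = conv P a r) -> (forall r, r%:R * b r = conv P b r) ->
  a =1 b.
Proof.
move=> reg P0 ab0 aE bE r; elim/ltn_ind: r => -[//|r] IH.
apply: (reg r); rewrite aE bE /conv [LHS]big_ord_recl [RHS]big_ord_recl P0 !mul0r.
congr (_ + _).
by apply: eq_bigr => i _; rewrite IH // lift0 subSS ltnS leq_subr.
Qed.

End Convolution.

Section Exponential.
Variables (G : comAlgType rat) (p : nat -> G).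

Definition plog (M : nat) : {poly G} :=
  \sum_(n < M.+1 | odd n) (2 / (n : nat)%:R *: p n) *: 'X^n.

Definition qgen (r : nat) : G :=
  \sum_(k < r.+1) ((k`!)%:R^-1 : rat) *: (plog r ^+ k)`_r.

(** The coefficients of z d/dz applied to the exponent 2 sum_(n odd) p_n z^n / n. *)
Definition pdouble (n : nat) : G := if odd n then p n *+ 2 else 0.

Lemma coef_plog M i :
  (plog M)`_i = if (i <= M)%N && odd i then 2 / i%:R *: p i else 0.
Proof.
rewrite coef_sum; case: leqP => [iM|Mi] /=; last first.
  rewrite big1 // => n _; rewrite coefZ coefXn gtn_eqF ?mulr0 //.
  exact: leq_trans (ltn_ord n) Mi.
case: ifP => odd_i; last first.
  rewrite big1 // => n odd_n; rewrite coefZ coefXn.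
  case: eqP => [e|_]; last by rewrite mulr0.
  by rewrite e odd_n in odd_i.
rewrite (bigD1 (Ordinal (iM : (i < M.+1)%N))) //= coefZ coefXn eqxx mulr1.
rewrite big1 ?addr0 // => n /andP[_]; rewrite -val_eqE /= => ne.
by rewrite coefZ coefXn eq_sym (negPf ne) mulr0.
Qed.

Lemma coef_plogX_trunc M M' k r : (r <= M)%N -> (r <= M')%N ->
  (plog M ^+ k)`_r = (plog M' ^+ k)`_r.
Proof.
elim: k r => [//|k IH] r rM rM'; rewrite !exprS !coefM; apply: eq_bigr => i _.
have ir : (i <= r)%N by rewrite -ltnS.
rewrite !coef_plog (leq_trans ir rM) (leq_trans ir rM') IH //.
  exact: leq_trans (leq_subr _ _) rM.
exact: leq_trans (leq_subr _ _) rM'.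
Qed.

Lemma coef_plogX_small M k r : (r < k)%N -> (plog M ^+ k)`_r = 0.
Proof.
elim: k r => [//|k IH] r rk; rewrite exprS coefM big_ord_recl coef_plog andbF.
rewrite mul0r add0r big1 // => i _; rewrite IH ?mulr0 // lift0.
have ir := ltn_ord i; case: r rk i ir => [|r] rk i ir; first by [].
by rewrite subSS (leq_ltn_trans (leq_subr _ _)).
Qed.

(** Allows all [qgen i] with [i] up to a bound to be computed from one polynomial [plog M] and one
    number of exponential terms, as [qgen_euler] requires. *)
Lemma qgenE M K r : (r <= M)%N -> (r < K)%N ->
  qgen r = \sum_(k < K) ((k`!)%:R^-1 : rat) *: (plog M ^+ k)`_r.
Proof.
move=> rM rK; rewrite /qgen -(subnKC rK) big_split_ord /=.
rewrite [X in _ = _ + X]big1 ?addr0 => [|k _]; last first.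
  by rewrite coef_plogX_small ?scaler0 //= leq_addr.
by apply: eq_bigr => k _; rewrite (coef_plogX_trunc k (leqnn r) rM).
Qed.

Lemma qgen0 : qgen 0 = 1.
Proof. by rewrite /qgen big_ord1 expr0 coef1 fact0 invr1 scale1r. Qed.

(** Differentiation of the exponential: z d/dz of L^(k+1) / (k+1)! is z L' times L^k / k!. *)
Lemma qgen_euler r : r%:R * qgen r = conv pdouble qgen r.
Proof.
case: r => [|r]; first by rewrite mul0r /conv big_ord1 mul0r.
have logE : 'X * (plog r.+1)^`() = \poly_(i < r.+2) pdouble i.
  apply/polyP=> i; rewrite coefXM coef_deriv coef_poly ltnS /pdouble.
  case: i => [//|i].
  rewrite coef_plog !ltnS; case: (i <= r)%N; last by rewrite mul0rn.
  rewrite andTb; case: (odd i.+1); last by rewrite mul0rn.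
  rewrite -scaler_nat scalerA mulrCA mulfV ?mulr1 ?pnatr_eq0 //.
  by rewrite scaler_nat.
rewrite [in LHS]/qgen big_ord_recl expr0 mulrDr.
have -> : (1 : {poly G})`_r.+1 = 0 by rewrite coef1.
rewrite scaler0 mulr0 add0r big_distrr /=.
transitivity (\sum_(k < r.+1) ((k`!)%:R^-1 : rat) *:
   \sum_(i < r.+2) pdouble i * (plog r.+1 ^+ k)`_(r.+1 - i)).
  apply: eq_bigr => k _; rewrite /bump leq0n add1n -scalerAr.
  have -> : r.+1%:R * (plog r.+1 ^+ k.+1)`_r.+1 =
      ('X * (plog r.+1 ^+ k.+1)^`())`_r.+1.
    by rewrite coefXM coef_deriv mulr_natl.
  rewrite deriv_exp /= mulrnAr coefMn mulrA logE coefM.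
  rewrite -scaler_nat scalerA factS natrM invfM mulrAC mulVf ?pnatr_eq0 //.
  rewrite mul1r; congr (_ *: _); apply: eq_bigr => i _.
  by rewrite coef_poly ltn_ord.
under eq_bigr => k _ do rewrite scaler_sumr.
rewrite exchange_big; apply: eq_bigr => i _ /=.
case: i => -[|i] i_lt /=; first by rewrite mul0r big1 // => k _; rewrite mul0r scaler0.
rewrite (@qgenE r.+1 r.+1) ?leq_subr ?subSS ?ltnS ?leq_subr //.
by rewrite big_distrr; apply: eq_bigr => k _; rewrite scalerAr.
Qed.

End Exponential.

Lemma natr_lreg (G : comAlgType rat) r : GRing.lreg (r.+1%:R : G).
Proof.
move=> x y; rewrite !mulr_natl -!scaler_nat.
by move/(congr1 ( *:%R r.+1%:R^-1)); rewrite !scalerA mulVf ?pnatr_eq0 // !scale1r.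
Qed.

Lemma natr_poly_lreg (G : comAlgType rat) r : GRing.lreg (r.+1%:R : {poly G}).
Proof.
move=> x y e; apply/polyP=> i; apply: (@natr_lreg G r).
by move/(congr1 (fun z : {poly G} => z`_i)): e; rewrite !mulr_natl !coefMn.
Qed.

(** * Two-row functions, their antisymmetric form, and the action of [D] on it *)

Section TwoRow.
Variables (G : comAlgType rat) (p : nat -> G).
Local Notation q := (qgen p).

(** This is Q(z) Q(-z) = 1: the exponent is odd in z, so the two logarithmic derivatives cancel. *)
Lemma qgen_inv r : (0 < r)%N -> conv q (fun i => (-1) ^+ i * q i) r = 0.
Proof.
case: r => // r _.
have minusE i : i%:R * ((-1) ^+ i * q i) =
    conv (fun i => - pdouble p i) (fun i => (-1) ^+ i * q i) i.
  rewrite mulrCA qgen_euler /conv big_distrr /=; apply: eq_bigr => j _.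
  have ji : (j <= i)%N by rewrite -ltnS.
  rewrite /pdouble; case: ifP => [odd_j|]; last by rewrite oppr0 !mul0r mulr0.
  rewrite -{1}(subnKC ji) exprD -signr_odd odd_j expr1; ring.
apply: (@natr_lreg G r); rewrite mulr0.
rewrite (convM_euler (@qgen_euler _ p) minusE) /conv big1 // => i _.
by rewrite subrr mul0r.
Qed.

Definition qtwo (r s : nat) : G :=
  q r * q s + 2 * \sum_(1 <= k < s.+1) (-1) ^+ k * q (r + k) * q (s - k).

Lemma qtwo0 r : qtwo r 0 = q r.
Proof. by rewrite /qtwo big_geq // mulr0 addr0 qgen0 mulr1. Qed.

(** Up to the sign (-1)^n, with n = b + 1, this is the coefficient of z^(2n) in Q(z) Q(-z), folded
    about its middle term. *)
Lemma qtwo_diag b : qtwo b.+1 b.+1 = 0.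
Proof.
pose n := b.+1; have := @qgen_inv (n + n) isT; rewrite /conv.
pose F i := q i * ((-1) ^+ (n + n - i) * q (n + n - i)).
rewrite -(big_mkord xpredT F) (@big_cat_nat _ _ _ n) /=; [|by []|exact/leqW/leq_addr].
rewrite [X in _ + X]big_ltn ?ltnS ?leq_addr // big_nat_rev /= add0n.
have -> : \sum_(n.+1 <= i < (n + n).+1) F i = \sum_(0 <= i < n) F (i + n.+1)%N.
  by rewrite -{1}(add0n n.+1) big_addn -addnS addnK.
rewrite addrCA -big_split /= /qtwo big_add1 /= -/n => sum0.
apply: (can_inj (signrMK n)); rewrite mulr0 -[RHS]sum0 mulrDr /F addnK.
congr (_ + _); first by rewrite mulrCA.
rewrite !big_distrr /=; apply: eq_big_nat => i /= i_lt.
have -> : (n + n - (n - i.+1) = n + i.+1)%N.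
  by rewrite subnBA // -addnA addnC addnK addnC.
have -> : (n + n - (i + n.+1) = n - i.+1)%N by rewrite addnS -addSn subnDr.
have -> : (-1) ^+ (n - i.+1) = (-1) ^+ n * (-1) ^+ i.+1 :> G.
  rewrite -[in RHS](subnK i_lt) exprD -mulrA -exprD addnn -mul2n exprM.
  by rewrite sqrrN expr1n expr1n mulr1.
have -> : (i + n.+1 = n + i.+1)%N by rewrite addnC addSn addnS.
rewrite exprD; ring.
Qed.

Lemma qtwoS r s : qtwo r.+1 s + qtwo r s.+1 = q r * q s.+1 - q r.+1 * q s.
Proof.
rewrite /qtwo big_add1 /= [X in _ + (_ + _ * X)]big_nat_recl //= big_add1 /=.
have -> : \sum_(0 <= i < s) (-1) ^+ i.+2 * q (r + i.+2) * q (s.+1 - i.+2) =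
    - \sum_(0 <= i < s) (-1) ^+ i.+1 * q (r.+1 + i.+1) * q (s - i.+1).
  rewrite -sumrN; apply: eq_bigr => i _; rewrite subSS addSnnS exprS; ring.
rewrite subSS subn0 addn1; ring.
Qed.

Definition qanti (a b : nat) : G :=
  if (b < a)%N then qtwo a b else if (a < b)%N then - qtwo b a else 0.

Lemma qantiC a b : qanti a b = - qanti b a.
Proof. by rewrite /qanti; case: ltngtP; rewrite ?oppr0 ?opprK. Qed.

(** Antisymmetry forces the value 0 at (0, 0), while q_0 = 1; hence the Kronecker term. *)
Lemma qanti0 a : qanti a 0 = q a - (a == 0%N)%:R.
Proof.
by rewrite /qanti ltn0; case: a => [|a]; rewrite ?qgen0 ?subrr // qtwo0 subr0.
Qed.

Lemma qantiSS a b :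
  qanti a b.+1 + qanti a.+1 b = q a * q b.+1 - q a.+1 * q b.
Proof.
wlog lt_ba : a b / (b < a)%N => [wl|].
  case: (ltngtP a b) => [lt_ab|/wl//|->].
    by rewrite qantiC addrC qantiC -opprD wl // opprB mulrC [q b * _]mulrC.
  by rewrite qantiC addNr mulrC subrr.
rewrite addrC -qtwoS; congr (_ + _); rewrite /qanti; first by rewrite ltnS ltnW.
(* If a = b + 1, the entry [qanti a b.+1] lies on the diagonal, where it is 0 by definition and
   agrees with [qtwo] by [qtwo_diag]. *)
move: lt_ba; rewrite leq_eqVlt => /predU1P[<-|lt_ba]; last by rewrite lt_ba.
by rewrite ltnn qtwo_diag.
Qed.

Definition seqshift (V : zmodType) (u : nat -> V) n :=
  if n is n'.+1 then u n' else 0.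

Lemma conv_shift (S : comNzRingType) (u v : nat -> S) n :
  conv (seqshift u) v n = seqshift (conv u v) n.
Proof.
case: n => [|n]; rewrite /conv big_ord_recl mul0r ?big_ord0 ?addr0 // add0r.
by apply: eq_bigr.
Qed.

(** With z marking [a] and w marking [b], this reads (z + w) A(z, w) = (z - w) (Q(z) Q(w) - 1). *)
Lemma qanti_shift a b :
  seqshift (qanti^~ b) a + seqshift (qanti a) b =
    seqshift q a * q b - q a * seqshift q b
    - ((a == 1%N) && (b == 0%N))%:R + ((a == 0%N) && (b == 1%N))%:R.
Proof.
case: a b => [|a] [|b] /=; rewrite ?qanti0 ?qgen0.
- ring.
- rewrite qantiC qanti0 /= ?eqSS; ring.
- by rewrite eqSS /= andbT; ring.
by rewrite qantiSS andbF subr0 addr0.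
Qed.

Variable D : {rmorphism G -> {poly G}}.
Hypothesis Dp : forall n, odd n -> D (p n) = (p n)%:P + 'X^n.

(* The coefficient of u ^ n in (1 + u) / (1 - u). *)
Definition fcoef n : nat := if n == 0%N then 1%N else 2%N.
Definition fpow n : {poly G} := 'X^n *+ fcoef n.

(** For F = (1 + u) / (1 - u) this is u F' = (2u / (1 - u^2)) F. The sum over odd [n] advances in
    steps of two, so the induction carries two consecutive cases. *)
Lemma fcoef_euler i :
  (i * fcoef i = \sum_(n < i.+1) (if odd n then 2 * fcoef (i - n) else 0))%N.
Proof.
pose S j := (\sum_(n < j.+1) (if odd n then 2 * fcoef (j - n) else 0))%N.
suff [] : (i * fcoef i = S i /\ i.+1 * fcoef i.+1 = S i.+1)%N by [].
rewrite /S {S}.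
elim: i => [|i [IH IH']]; first by rewrite !(big_ord_recl, big_ord0).
split=> //; rewrite big_ord_recl [X in (_ + X)%N]big_ord_recl /=.
under eq_bigr => n _ do rewrite !subSS negbK.
by rewrite -IH /fcoef /=; case: i {IH IH'} => //= i; ring.
Qed.

Lemma fpow_euler i :
  i%:R * fpow i = conv (fun n => if odd n then 'X^n *+ 2 else 0) fpow i.
Proof.
rewrite /fpow mulrnAr mulr_natl -mulrnA fcoef_euler /conv -sumrMnr.
apply: eq_bigr => n _; case: ifP => _; last by rewrite mul0r.
rewrite mulrnAr mulrnAl -mulrnA -exprD subnKC -1?ltnS //.
Qed.

(** With z for the polynomial variable, [D] adds 2 sum_(n odd) (u z)^n / n to the exponent of Q(u),
    that is, multiplies Q(u) by (1 + u z) / (1 - u z). The proof compares logarithmic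
    derivatives. *)
Lemma shift_qgen a : D (q a) = conv (fun i => (q i)%:P) fpow a.
Proof.
pose P i : {poly G} := (pdouble p i)%:P + (if odd i then 'X^i *+ 2 else 0).
move: a; apply: (@conv_euler_uniq _ P (fun a => D (q a))) => [r|||r|r].
- exact: natr_poly_lreg.
- by rewrite /P /= addr0.
- by rewrite qgen0 rmorph1 /conv big_ord1 qgen0 mul1r.
- rewrite -(rmorph_nat D) -rmorphM qgen_euler rmorph_sum; apply: eq_bigr => i _.
  rewrite rmorphM /pdouble /P; congr (_ * _); rewrite /pdouble; case: ifP => odd_i.
    by rewrite rmorphMn /= Dp // mulrnDl polyCMn.
  by rewrite rmorph0 addr0.
apply: convM_euler => [i|]; last exact: fpow_euler.
rewrite -(rmorph_nat (@polyC G)) -rmorphM qgen_euler rmorph_sum.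
by apply: eq_bigr => j _; rewrite rmorphM.
Qed.

(** The form [qanti] after both indices undergo e_a |-> sum_i [fpow i] e_(a-i). *)
Definition qanti_spread a b : {poly G} :=
  conv (fun i => conv (fun j => (qanti i j)%:P) fpow b) fpow a.

Lemma conv_lincomb (S : comNzRingType) (x y z t : S) u v w s f n :
  conv (fun i => x * u i - y * v i - z * w i + t * s i) f n =
    x * conv u f n - y * conv v f n - z * conv w f n + t * conv s f n.
Proof.
rewrite /conv !big_distrr /= -!sumrB -big_split /=.
by apply: eq_bigr => i _; ring.
Qed.

Lemma spread_delta k n : (k <= n)%N ->
  conv (fun i => (i == k)%:R) fpow n = fpow (n - k).
Proof.
move=> kn; rewrite /conv (bigD1 (Ordinal (kn : (k < n.+1)%N))) //= eqxx mul1r.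
by rewrite big1 ?addr0 // => i /negPf; rewrite -val_eqE /= => ->; rewrite mul0r.
Qed.

(** This is [qanti_shift] convolved with [fpow] in both indices and evaluated at (a + 1, b + 1);
    convolution commutes with [seqshift], which lowers an index by one. *)
Lemma qanti_spreadSS a b :
  qanti_spread a b.+1 + qanti_spread a.+1 b =
    D (q a) * D (q b.+1) - D (q a.+1) * D (q b)
    - fpow a * fpow b.+1 + fpow a.+1 * fpow b.
Proof.
pose Q i : {poly G} := (q i)%:P; pose sQ := seqshift Q.
pose delta (k i : nat) : {poly G} := (i == k)%:R.
have sQE i : (seqshift q i)%:P = sQ i by case: i.
have convsQ n : conv sQ fpow n.+1 = D (q n).
  by rewrite conv_shift /= shift_qgen.
have conv_delta k n : (k <= n)%N -> conv (delta k) fpow n = fpow (n - k).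
  exact: spread_delta.
transitivity (conv (fun i => conv (fun j =>
    sQ i * Q j - Q i * sQ j - delta 1%N i * delta 0%N j
    + delta 0%N i * delta 1%N j) fpow b.+1) fpow a.+1); last first.
  transitivity (conv (fun i => D (q b.+1) * sQ i - D (q b) * Q i
      - fpow b.+1 * delta 1%N i + fpow b * delta 0%N i) fpow a.+1).
    apply: eq_conv => // i; rewrite conv_lincomb convsQ -shift_qgen.
    by rewrite !conv_delta // subn0 subSS subn0; ring.
  rewrite conv_lincomb convsQ -shift_qgen !conv_delta // subn0 subSS subn0.
  ring.
have spread_Sr : qanti_spread a b.+1 = conv (fun i =>
    conv (fun j => (seqshift (qanti^~ j) i)%:P) fpow b.+1) fpow a.+1.
  transitivity (seqshift (qanti_spread^~ b.+1) a.+1) => //.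
  rewrite -conv_shift; apply: eq_conv => // -[|i] //=.
  by rewrite /conv big1 // => j _; rewrite mul0r.
have spread_Sl : qanti_spread a.+1 b = conv (fun i =>
    conv (fun j => (seqshift (qanti i) j)%:P) fpow b.+1) fpow a.+1.
  apply: eq_conv => // i.
  transitivity (seqshift (conv (fun j => (qanti i j)%:P) fpow) b.+1) => //.
  by rewrite -conv_shift; apply: eq_conv => // -[|j].
rewrite spread_Sr spread_Sl -convDl; apply: eq_conv => // i.
rewrite -convDl; apply: eq_conv => // j; rewrite -polyCD qanti_shift.
rewrite polyCD !polyCB !polyCM !sQE !(rmorph_nat (@polyC G)) /delta.
by rewrite -!natrM !mulnb.
Qed.

(** Induction on [b]: [qantiSS] and [qanti_spreadSS] trade (a, b + 1) for (a + 1, b). The correction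
    terms stem from q_0 = 1 and vanish at positive indices. *)
Lemma shift_qanti a b : D (qanti a b) =
  qanti_spread a b + fpow a *+ (b == 0%N) - fpow b *+ (a == 0%N).
Proof.
elim: b a => [|b IH] a.
  rewrite qanti0 rmorphB rmorph_nat /= shift_qgen mulr1n.
  have -> : qanti_spread a 0 = conv (fun i => (q i)%:P) fpow a - fpow a.
    transitivity (conv (fun i => (q i)%:P + - (i == 0%N)%:R) fpow a).
      apply: eq_conv => // i; rewrite [LHS]big_ord1 qanti0 polyCB.
      by rewrite (rmorph_nat (@polyC G)) /fpow expr0 mulr1.
    rewrite convDl; congr (_ + _); rewrite -[in RHS](subn0 a).
    rewrite -spread_delta // /conv -sumrN.
    by apply: eq_bigr => i _; rewrite mulNr.
  rewrite subrK; congr (_ - _); by rewrite /fpow /= expr0.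
have := IH a.+1; have := congr1 D (qantiSS a b).
rewrite !rmorphD rmorphN !rmorphM /= => /(canRL (addrK _)) -> ->.
have /(canRL (addrK _)) -> := qanti_spreadSS a b.
rewrite /= mulr0n addr0 subr0.
(* The two products on the right agree unless exactly one of [a], [b] is 0, where [fcoef] drops from
   2 to 1. *)
suff : fpow a.+1 *+ (b == 0%N) - fpow b.+1 *+ (a == 0%N) =
  fpow a * fpow b.+1 - fpow a.+1 * fpow b.
  by move/(canRL (subrK _)) => ->; ring.
rewrite /fpow /fcoef; case: a => [|a]; case: b {IH} => [|b] /=;
  rewrite ?expr0 ?exprS; ring.
Qed.

End TwoRow.

(** * The adjoint of multiplication by q_r *)

Section Adjoint.
Variables (G : comAlgType rat) (p : nat -> G).
Local Notation q := (qgen p).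
Hypothesis G_ind : forall P : G -> Prop, P 1 ->
  (forall (a : rat) g h, P g -> P h -> P (a *: g + h)) ->
  (forall n g, odd n -> P g -> P (p n * g)) -> forall g, P g.
Variables (D : {rmorphism G -> {poly G}}) (d : nat -> {linear G -> G}).
Variable pair : G -> G -> rat.
Hypothesis DZ : forall (c : rat) g, D (c *: g) = (c *: 1)%:P * D g.
Hypothesis Dp : forall n, odd n -> D (p n) = (p n)%:P + 'X^n.
Hypothesis dp : forall n m, odd n -> odd m -> d n (p m) = (m == n)%:R.
Hypothesis dM : forall n g h, d n (g * h) = d n g * h + g * d n h.
Hypothesis pairC : forall g h, pair g h = pair h g.
Hypothesis pair_lin : forall h, linear_for *%R (pair h).
Hypothesis pair_p : forall n g h, odd n ->
  pair (p n * g) h = n%:R / 2 * pair g (d n h).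

HB.instance Definition _ h :=
  GRing.isLinear.Build rat G rat *%R (pair h) (pair_lin h).

Lemma derivation1 n : d n 1 = 0.
Proof.
by have := dM n 1 1; rewrite !mul1r mulr1 -[LHS]addr0 => /addrI ->.
Qed.

Lemma iter_seqshift (V : zmodType) (u : nat -> V) n m :
  iter n (@seqshift V) u m = if (n <= m)%N then u (m - n)%N else 0.
Proof.
elim: n m => [|n IH] [|m] //=; by rewrite IH ltnS subSS.
Qed.

Lemma conv_iter_shift (u v : nat -> G) n :
  conv (iter n (@seqshift _) u) v =1 iter n (@seqshift _) (conv u v).
Proof.
elim: n => [//|n IH] m; rewrite /= conv_shift.
by case: m => //= m; rewrite IH.
Qed.

(** Differentiation by p_n multiplies Q(z) by 2 z^n / n. Both sides y satisfy z y' = n z^n Q + P y,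
    with P the series of [pdouble], and this determines the coefficients recursively. *)
Lemma derivation_qgen n r : odd n ->
  (n%:R / 2 : rat) *: d n (q r) = if (n <= r)%N then q (r - n) else 0.
Proof.
move=> odd_n; pose c : rat := n%:R / 2; pose qs := iter n (@seqshift G) q.
rewrite -iter_seqshift -/c -/qs.
have qs_euler m : m%:R * qs m = n%:R * qs m + conv (pdouble p) qs m.
  rewrite (convC _ _ m) conv_iter_shift /qs !iter_seqshift.
  case: leqP => nm; last by rewrite !mulr0 addr0.
  rewrite convC -qgen_euler -mulrDl -natrD subnKC //.
have cdq_euler m : m%:R * (c *: d n (q m)) =
    n%:R * qs m + conv (pdouble p) (fun i => c *: d n (q i)) m.
  have -> : m%:R * (c *: d n (q m)) = c *: d n (m%:R * q m).
    by rewrite !mulr_natl linearMn scalerMnr.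
  rewrite qgen_euler /conv raddf_sum scaler_sumr /=.
  have dP i : d n (pdouble p i) = (i == n)%:R *+ 2.
    rewrite /pdouble; case: ifP => odd_i; first by rewrite linearMn /= dp.
    rewrite linear0; case: eqP => [e|_]; last by rewrite mul0rn.
    by rewrite e odd_n in odd_i.
  under eq_bigr => i _ do rewrite dM scalerDr dP [X in _ + X]scalerAr.
  rewrite big_split /=; congr (_ + _); rewrite /qs iter_seqshift.
  case: leqP => [nm|mn].
    rewrite (bigD1 (Ordinal (nm : (n < m.+1)%N))) //= eqxx big1 ?addr0.
      rewrite mulrnAl mul1r mulr_natl -!scaler_nat scalerA.
      by rewrite /c divfK ?pnatr_eq0.
    move=> i; rewrite -val_eqE /= => /negPf ->.
    by rewrite mul0rn mul0r scaler0.
  rewrite mulr0 big1 // => i _; have i_lt := ltn_ord i.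
  rewrite ltn_eqF ?mul0rn ?mul0r ?scaler0 //; exact: leq_ltn_trans mn.
elim/ltn_ind: r => -[|r] IH.
  rewrite qgen0 derivation1 scaler0 /qs iter_seqshift leqn0.
  by case: eqP odd_n => // ->.
apply: (@natr_lreg G r); rewrite qs_euler cdq_euler; congr (_ + _).
rewrite /conv [LHS]big_ord_recl [RHS]big_ord_recl /= !mul0r; congr (_ + _).
by apply: eq_bigr => i _; rewrite IH // subSS ltnS leq_subr.
Qed.

(** For r > 0 the Euler relation puts q_r into the ideal of the odd p_n, whose adjoints kill 1. *)
Lemma pair_qgen1 r g : pair (q r * g) 1 = pair g 1 *+ (r == 0%N).
Proof.
case: r => [|r]; first by rewrite qgen0 mul1r.
have pair_p1 n x : odd n -> pair (p n * x) 1 = 0.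
  by move=> odd_n; rewrite pair_p // derivation1 linear0 mulr0.
have : pair (r.+1%:R * q r.+1 * g) 1 = 0.
  rewrite qgen_euler /conv big_distrl pairC linear_sum big1 //= => i _.
  rewrite pairC /pdouble; case: ifP => [odd_i|]; last first.
    by rewrite !mul0r pairC linear0.
  by rewrite -mulrA mulrnAl pairC linearMn /= pairC pair_p1.
rewrite -mulrA mulr_natl pairC linearMn /= pairC => /eqP.
by rewrite mulrn_eq0 => /eqP.
Qed.

(** Induction on [h]. Moving a factor p_n of [h] to the other side differentiates q_r g, and the two
    Leibniz terms match the two summands of D(p_n) = p_n + z^n. *)
Lemma pair_qgen r g h : pair (q r * g) h = pair g (D h)`_r.
Proof.
move: h r g; apply: G_ind => [r g|a h1 h2 IH1 IH2 r g|n h odd_n IH r g].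
- rewrite pair_qgen1 rmorph1 coef1; case: eqP => _ //.
  by rewrite linear0.
- rewrite linearP /= IH1 IH2 rmorphD DZ coefD coefCM -scalerAl mul1r.
  by rewrite linearP.
rewrite pairC pair_p // dM linearD /= mulrDr rmorphM Dp // mulrDl coefD.
rewrite coefCM coefXnM linearD /= [RHS]addrC; congr (_ + _).
  rewrite -linearZ /= scalerAl derivation_qgen //.
  rewrite [LHS]pairC.
  case: ltnP => nr; first by rewrite mul0r pairC linear0 linear0.
  by rewrite IH.
by rewrite [LHS]mulrC pairC IH [RHS]pairC pair_p // pairC mulrC.
Qed.

End Adjoint.

(** * Pfaffians over extended index sequences *)

Section SchurQ.
Variables (G : comAlgType rat) (p : nat -> G).
Local Notation q := (qgen p).

(* None stands for the zero part appended to a partition of odd length; as  *)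
(* opposed to Some 0, it pairs with Some 0 to q_0 = 1.                       *)
Definition qform (x y : option nat) : G :=
  match x, y with
  | Some a, Some b => qanti p a b
  | Some a, None => q a
  | None, Some b => - q b
  | None, None => 0
  end.

Lemma qformC x y : qform x y = - qform y x.
Proof.
by case: x y => [a|] [b|] //=; rewrite ?opprK ?oppr0 // qantiC.
Qed.

Lemma qformxx x : qform x x = 0.
Proof. by case: x => [a|] //=; rewrite /qanti ltnn. Qed.

Lemma qform0 a : (0 < a)%N -> qform (Some a) (Some 0%N) = q a.
Proof. by case: a => // a _; rewrite /= qanti0 subr0. Qed.

Definition qmatrix m (x : nat -> option nat) : 'M[G]_(m.*2) :=
  \matrix_(i, j) qform (x i) (x j).

Definition qpf m (x : nat -> option nat) : G :=
  ((2 ^ m * m`!)%N%:R^-1 : rat) *: pfsum (qmatrix m x).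

Lemma eq_qmatrix m x y : (forall i, (i < m.*2)%N -> x i = y i) ->
  qmatrix m x = qmatrix m y.
Proof. by move=> xy; apply/matrixP=> i j; rewrite !mxE !xy. Qed.

Definition rowindex (t : seq nat) (i : nat) : option nat :=
  if (i < size t)%N then Some (nth 0%N t i) else None.

(** The parts of [t], then an explicit index 0, then oo: the sequence left behind both by expanding
    the first row and by taking the top coefficient under [D]. *)
Definition rowindex0 (t : seq nat) (i : nat) : option nat :=
  rowindex (rcons t 0%N) i.

Definition qschur (t : seq nat) : G := qpf (uphalf (size t)) (rowindex t).

Lemma rowindex0_lt t i : (i < size t)%N -> rowindex0 t i = Some (nth 0%N t i).
Proof.
move=> i_lt.
by rewrite /rowindex0 /rowindex size_rcons ltnS ltnW // nth_rcons i_lt.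
Qed.

Lemma rowindex0_eq t : rowindex0 t (size t) = Some 0%N.
Proof. by rewrite /rowindex0 /rowindex size_rcons ltnSn nth_rcons ltnn eqxx. Qed.

Lemma rowindex0_gt t i : (size t < i)%N -> rowindex0 t i = None.
Proof.
by move=> i_gt; rewrite /rowindex0 /rowindex size_rcons ltnS leqNgt i_gt.
Qed.

Lemma Gdouble_eq0 (x : G) : x *+ 2 = 0 -> x = 0.
Proof.
by move=> x2; apply: (@natr_lreg G 1); rewrite mulr0 mulr_natl.
Qed.

Lemma pfsum_cross_repeat m (x : nat -> option nat) (i j : 'I_m.*2) : i != j ->
  pfsum (set_cross i (fun k => qform (x j) (x k)) (qmatrix m x)) = 0.
Proof.
move=> ij; apply: Gdouble_eq0.
pose x' k := if k == i :> nat then x j else x k.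
have -> : pfsum (set_cross i (fun k => qform (x j) (x k)) (qmatrix m x)) =
    pfsum (qmatrix m x').
  have -> : qmatrix m x' = set_cross i (fun k => qform (x j) (x' k)) (qmatrix m x).
    apply/matrixP=> a b; rewrite !mxE /x' -!val_eqE /=.
    case: eqP => // _; case: eqP => // _; exact: qformC.
  by apply: pfsum_cross_eq => k; rewrite /x' -val_eqE /= => /negPf ->.
apply: (pfsum_repeat ij) => a b; rewrite !mxE.
have x't c : x' (tperm i j c) = x' c.
  case: tpermP => [->|->|//]; rewrite /x' eqxx; last by case: eqP.
  by rewrite [j == i :> nat]eq_sym -val_eqE in ij *; rewrite (negPf ij).
by rewrite !x't.
Qed.

Lemma pfsum_drop m (x : nat -> option nat) :
    (forall i, (i < m.*2)%N -> exists a, x i = Some a.+1) ->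
    x m.*2 = Some 0%N -> x m.*2.+1 = None ->
  pfsum (qmatrix m.+1 x) = (m.+1.*2)%:R * pfsum (qmatrix m x).
Proof.
move=> x_pos x0 xoo.
pose r : 'I_m.+1.*2 := ord_even ord_max; pose r' : 'I_m.+1.*2 := ord_odd ord_max.
pose delta (k : 'I_m.+1.*2) : G := (k == r')%:R.
have rr' : r != r' by rewrite -val_eqE /= ltn_eqF.
have crossE : pfsum (qmatrix m.+1 x) = pfsum (set_cross r delta (qmatrix m.+1 x)).
  (* For a > 0, A(0, a) = -q_a = A(oo, a), and A(0, oo) = 1: the row of 0 is the row of oo plus
     [delta], and the repeated row of oo contributes 0. *)
  pose v (c : bool) k := if c then delta k else qform (x r') (x k).
  have := @pfsum_cross_sum _ _ r bool (fun=> 1) v (qmatrix m.+1 x).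
  rewrite big_bool !mul1r /= pfsum_cross_repeat // addr0 => <-.
  have rowE : qmatrix m.+1 x =
      set_cross r (fun k => qform (x r) (x k)) (qmatrix m.+1 x).
    apply/matrixP=> a b; rewrite !mxE; case: eqP => [->//|_].
    by case: eqP => [->|//]; exact: qformC.
  rewrite [in LHS]rowE; apply: pfsum_cross_eq => j.
  rewrite big_bool !mul1r /v /delta -!val_eqE /= x0 xoo => jr.
  have [jr'|jr'] := eqVneq (j : nat) m.*2.+1.
    by rewrite jr' xoo /= qgen0 addr0.
  have [|a ->] := x_pos j; first by have : (j < m.*2.+2)%N := ltn_ord j; lia.
  by rewrite /= qantiC qanti0 subr0 add0r.
have ord_max2 (i : 'I_m.*2) : val (lift (ord_max : 'I_m.*2.+2)
    (lift (ord_max : 'I_m.*2.+1) i)) = i.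
  by rewrite /= /bump; have := ltn_ord i; lia.
rewrite crossE pfsum_peel.
- congr (_ * pfsum _); apply/matrixP=> i j; rewrite !mxE -!val_eqE !ord_max2.
  by rewrite !ltn_eqF.
- move=> i j; rewrite !mxE.
  have [->|ir] := eqVneq i r; have [jr|jr] := eqVneq j r; rewrite ?opprK //.
    by rewrite jr /delta (negPf rr') oppr0.
  exact: qformC.
- by move=> k /negPf kr'; rewrite mxE eqxx /delta kr'.
by rewrite mxE eqxx /delta eqxx.
Qed.

Lemma nth_pos (t : seq nat) i :
  0%N \notin t -> (i < size t)%N -> (0 < nth 0%N t i)%N.
Proof.
move=> t0 i_lt; rewrite lt0n; apply: contraNneq t0 => <-; exact: mem_nth.
Qed.

(** For odd length the appended 0 takes the place of oo and pairs in the same way with positive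
    parts. For even length 0 and oo form an extra pair, removed by [pfsum_drop], whose numerical
    factor is the quotient of the two normalizations. *)
Lemma qpf_tail t : 0%N \notin t -> qpf (size t)./2.+1 (rowindex0 t) = qschur t.
Proof.
move=> t0; rewrite /qschur; have [odd_t|even_t] := boolP (odd (size t)).
  have sizeE : size t = (size t)./2.*2.+1 by rewrite -[LHS]odd_double_half odd_t.
  have -> : uphalf (size t) = (size t)./2.+1 by rewrite uphalf_half odd_t.
  congr (_ *: pfsum _); apply/matrixP=> i j; rewrite !mxE.
  have rowE (k : 'I_(size t)./2.+1.*2) :
      (exists2 a, rowindex t k = Some a.+1 & rowindex0 t k = Some a.+1) \/
      rowindex0 t k = Some 0%N /\ rowindex t k = None.
    have k_le : (k <= size t)%N.
      by have : (k < ((size t)./2).*2.+2)%N := ltn_ord k; lia.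
    case: (ltngtP k (size t)) k_le => // [k_lt|->] _.
      left; rewrite rowindex0_lt // /rowindex k_lt.
      by have := nth_pos t0 k_lt; case: nth => // a _; exists a.
    by right; rewrite rowindex0_eq /rowindex ltnn.
  have zeroE a : qform (Some a.+1) (Some 0%N) = qform (Some a.+1) None.
    exact: qform0.
  case: (rowE i) (rowE j) => [[a -> ->]|[-> ->]] [[b -> ->]|[-> ->]] //.
    by rewrite qformC zeroE -qformC.
have sizeE : size t = (size t)./2.*2.
  by rewrite -[LHS]odd_double_half (negPf even_t).
have -> : uphalf (size t) = (size t)./2 by rewrite uphalf_half (negPf even_t).
rewrite /qpf pfsum_drop.
- rewrite mulr_natl -scaler_nat scalerA.
  rewrite (@eq_qmatrix _ (rowindex0 t) (rowindex t)); last first.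
    by move=> i; rewrite -sizeE => i_lt; rewrite rowindex0_lt // /rowindex i_lt.
  rewrite expnS factS [in LHS]mulnACA natrM invfM mulrAC -muln2 [(_ * 2)%N]mulnC.
  by rewrite mulVf ?mul1r // pnatr_eq0.
- move=> i; rewrite -sizeE => i_lt; rewrite rowindex0_lt //.
  by have := nth_pos t0 i_lt; case: nth => // a _; exists a.
- by rewrite -sizeE rowindex0_eq.
by rewrite -sizeE rowindex0_gt.
Qed.

End SchurQ.

(** * Expansion of Q_lambda along its first row *)

Section FirstRow.
Variables (G : comAlgType rat) (p : nat -> G).
Local Notation q := (qgen p).
Local Notation qform := (qform p).
Local Notation qmatrix := (qmatrix p).
Variables (h : nat) (t : seq nat).
Hypothesis t_pos : 0%N \notin t.
Hypothesis t_lt : all (fun b => b < h)%N t.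

Let m := (size t)./2.
Let x := rowindex (h :: t).

Let size_lt : (size t < m.+1.*2)%N.
Proof. rewrite /m; lia. Qed.

Let x0 : x 0 = Some h. Proof. by []. Qed.

Let xS i : x i.+1 = rowindex t i. Proof. by []. Qed.

(** The two-row formula writes the row of [h] as a combination of the [q (h + k)]; these are its
    coefficients, which do not involve [h]. *)
Definition row_expansion (k : nat) (z : option nat) : G :=
  match z with
  | Some b => if k == 0%N then q b
              else if (k <= b)%N then 2 * (-1) ^+ k * q (b - k) else 0
  | None => (k == 0%N)%:R
  end.

Lemma qform_expand z : (if z is Some b then b < h else true)%N ->
  qform (Some h) z = \sum_(k < h.+1) q (h + k) * row_expansion k z.
Proof.
case: z => [b|_] /= => [b_lt|]; rewrite big_ord_recl /= addn0; last first.
  by rewrite mulr1 big1 ?addr0 // => k _; rewrite mulr0.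
rewrite /qanti b_lt /qtwo; congr (_ + _); rewrite big_add1 /= big_mkord.
pose term k := (-1) ^+ k.+1 * q (h + k.+1) * q (b - k.+1).
rewrite (big_ord_widen _ term (ltnW b_lt)) /term.
rewrite big_mkcond big_distrr /=; apply: eq_bigr => k _.
by rewrite /bump leq0n add1n; case: ifP => _; ring.
Qed.

Let r0 : 'I_m.+1.*2 := ord0.

(** The index 0 put in front is moved behind [t] by the cycle [s], of sign (-1)^(size t). *)
Lemma pfsum_new_zero : pfsum (set_cross r0 (fun j => qform (Some 0%N) (x j))
    (qmatrix m.+1 x)) = (-1) ^+ size t * pfsum (qmatrix m.+1 (rowindex0 t)).
Proof.
pose j0 : 'I_m.*2.+2 := Ordinal (size_lt : (size t < m.*2.+2)%N).
pose s : 'S_m.+1.*2 := lift_perm (ord0 : 'I_m.*2.+2) j0 1.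
have -> : (-1) ^+ size t = (-1) ^+ s :> G.
  by rewrite odd_lift_perm odd_perm1 addbF signr_odd.
rewrite -pfsum_perm.
have sE (i : 'I_m.+1.*2) : i != r0 -> rowindex0 t (s i) = x i.
  case: (unliftP (ord0 : 'I_m.*2.+2) i) => [k ->|-> /eqP//] _.
  rewrite /s lift_perm_lift perm1 lift0 xS /rowindex /= /bump.
  case: ltnP => [k_lt|k_ge]; first by rewrite rowindex0_lt.
  by rewrite rowindex0_gt.
have s0 : rowindex0 t (s r0) = Some 0%N.
  by rewrite /s lift_perm_id rowindex0_eq.
have -> : \matrix_(i, j) qmatrix m.+1 (rowindex0 t) (s i) (s j) =
    set_cross r0 (fun j => qform (Some 0%N) (rowindex0 t (s j))) (qmatrix m.+1 x).
  apply/matrixP=> i j; rewrite !mxE.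
  have [->|ir] := eqVneq i r0; first by rewrite s0.
  have [->|jr] := eqVneq j r0; first by rewrite s0 -qformC.
  by rewrite !sE.
by apply: pfsum_cross_eq => j /sE ->.
Qed.

(** The row b |-> q_b, oo |-> 1 is minus the row of 0 if [t] has odd length, when oo does not occur.
    For even length it is the row of 0 minus twice the row of oo, and the latter repeats a row
    already present. *)
Lemma pfsum_leading_row :
  pfsum (set_cross r0 (fun j => row_expansion 0 (x j)) (qmatrix m.+1 x)) =
    pfsum (qmatrix m.+1 (rowindex0 t)).
Proof.
pose c (b : bool) : G :=
  if b then (-1) ^+ size t else if odd (size t) then 0 else - 2.
pose v (b : bool) (j : 'I_m.+1.*2) :=
  if b then qform (Some 0%N) (x j) else qform None (x j).
transitivity (pfsum (set_cross r0 (fun j => \sum_b c b * v b j) (qmatrix m.+1 x))).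
  apply: pfsum_cross_eq => j; rewrite -val_eqE /= big_bool /c /v /=.
  case: (j : nat) (ltn_ord j) => // i i_lt _; rewrite xS /rowindex -signr_odd.
  case: ltnP => [it|ti] /=.
    have := nth_pos t_pos it; case: nth => // b _.
    by rewrite qantiC qanti0; case: odd => /=; ring.
  rewrite qgen0; case: ifP => [odd_t|_]; last by ring.
  by have : (i.+1 < m.*2.+2)%N := i_lt; rewrite /m in ti *; lia.
have big_boolD (F : bool -> G) : \sum_b F b = F true + F false.
  by rewrite big_bool.
rewrite pfsum_cross_sum big_boolD [X in c true * X]pfsum_new_zero signrMK /c.
case: ifP => [_|even_t]; first by rewrite mul0r addr0.
have last_lt : ((size t).+1 < m.+1.*2)%N.
  by have : (size t < m.*2.+2)%N := size_lt; rewrite /m; lia.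
have xoo : x (Ordinal last_lt) = None by rewrite /= xS /rowindex ltnn.
by rewrite /v -xoo pfsum_cross_repeat ?mulr0 ?addr0.
Qed.

(** The summand k = 0 of the first row gives the product with [q h]. Of the others only the factors
    q_(h+k) matter for orthogonality, so the cofactors [X] stay unspecified. *)
Lemma qschur_cons : exists X : nat -> G,
  qschur p (h :: t) = q h * qschur p t + \sum_(k < h) q (h + k.+1) * X k.
Proof.
pose c : rat := (2 ^ m.+1 * m.+1`!)%N%:R^-1.
exists (fun k => c *: pfsum
  (set_cross r0 (fun j => row_expansion k.+1 (x j)) (qmatrix m.+1 x))).
have -> : qschur p (h :: t) = c *: pfsum (qmatrix m.+1 x) by [].
have -> : pfsum (qmatrix m.+1 x) =
    pfsum (set_cross r0
      (fun j => \sum_(k < h.+1) q (h + k) * row_expansion k (x j))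
      (qmatrix m.+1 x)).
  have {1}-> : qmatrix m.+1 x =
      set_cross r0 (fun j => qform (Some h) (x j)) (qmatrix m.+1 x).
    apply/matrixP=> i j; rewrite !mxE; case: eqP => [->//|_].
    by case: eqP => [->|//]; exact: qformC.
  apply: pfsum_cross_eq => j j_neq0; rewrite qform_expand //.
  rewrite -val_eqE /= in j_neq0; case: (j : nat) j_neq0 => // i _.
  by rewrite xS /rowindex; case: ltnP => // i_lt; apply: (all_nthP 0%N t_lt).
rewrite pfsum_cross_sum big_ord_recl /= addn0 pfsum_leading_row scalerDr.
rewrite scalerAr -(qpf_tail _ t_pos); congr (_ + _).
by rewrite scaler_sumr; apply: eq_bigr => k _; rewrite scalerAr.
Qed.

End FirstRow.

(** * The top coefficient of D Q_lambda *)

Section TopShift.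
Variables (G : comAlgType rat) (p : nat -> G).
Local Notation q := (qgen p).
Local Notation qform := (qform p).
Local Notation qmatrix := (qmatrix p).
Variable D : {rmorphism G -> {poly G}}.
Hypothesis DZ : forall (c : rat) g, D (c *: g) = (c *: 1)%:P * D g.
Hypothesis Dp : forall n, odd n -> D (p n) = (p n)%:P + 'X^n.
Variables (h : nat) (t : seq nat).
Hypothesis lam_pos : 0%N \notin h :: t.
Hypothesis lam_sorted : sorted gtn (h :: t).

Let m := (size t)./2.
Let lam := h :: t.
Let x := rowindex lam.
Let y := rowindex0 t.

(** Numbers the indices oo, 0, ..., h as 0, 1, ..., h + 1, so that coordinate vectors are functions
    on [nat]. *)
Definition code (k : nat) : option nat := if k is a.+1 then Some a else None.

(** Coordinates of the image of e_z under the action of [D] on indices; oo is fixed. *)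
Definition rowvec (z : option nat) (k : nat) : {poly G} :=
  match z, k with
  | Some a, b.+1 => if (b <= a)%N then fpow G (a - b) else 0
  | None, 0 => 1
  | _, _ => 0
  end.

Definition rowform (u v : nat -> {poly G}) : {poly G} :=
  \sum_(a < h.+2) \sum_(b < h.+2) u a * v b * (qform (code a) (code b))%:P.

Lemma sum_rowvec a (F : nat -> {poly G}) : (a <= h)%N ->
  \sum_(k < h.+2) rowvec (Some a) k * F k = conv (fun i => F i.+1) (@fpow G) a.
Proof.
move=> ah; rewrite big_ord_recl mul0r add0r /conv.
rewrite (big_ord_widen _ (fun i => F i.+1 * fpow G (a - i)) (ah : (a.+1 <= h.+1)%N)).
rewrite [RHS]big_mkcond; apply: eq_bigr => i _; rewrite lift0 /= ltnS.
by case: ifP => _; rewrite ?mul0r // mulrC.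
Qed.

Lemma sum_rowvec_None (F : nat -> {poly G}) : \sum_(k < h.+2) rowvec None k * F k = F 0%N.
Proof.
rewrite big_ord_recl mul1r big1 ?addr0 // => i _; rewrite lift0 mul0r //.
Qed.

Lemma rowformE u v : rowform u v =
  \sum_(a < h.+2) u a * \sum_(b < h.+2) v b * (qform (code a) (code b))%:P.
Proof.
apply: eq_bigr => a _; rewrite big_distrr; apply: eq_bigr => b _.
exact: esym (mulrA _ _ _).
Qed.

(** A part 0 is excluded because the correction terms of [shift_qanti] would appear. *)
Definition bounded_index (z : option nat) : bool :=
  if z is Some a then (0 < a <= h)%N else true.

Lemma shift_qform z w : bounded_index z -> bounded_index w ->
  D (qform z w) = rowform (rowvec z) (rowvec w).
Proof.
pose A j k : {poly G} := (qform (code j) (code k))%:P.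
pose B u j := \sum_(k < h.+2) rowvec u k * A j k.
rewrite rowformE -/(\sum_(j < h.+2) rowvec z j * B w j).
case: z w => [a|] [b|] /=.
- move=> /andP[a0 ah] /andP[b0 bh].
  rewrite sum_rowvec // shift_qanti // !gtn_eqF // mulr0n addr0 subr0.
  by apply: eq_conv => // i; rewrite /B sum_rowvec.
- move=> /andP[a0 ah] _; rewrite sum_rowvec // shift_qgen //.
  by apply: eq_conv => // i; rewrite /B (sum_rowvec_None (A i.+1)).
- move=> _ /andP[b0 bh].
  rewrite (sum_rowvec_None (B (Some b))) /B (sum_rowvec (A 0%N)) //.
  rewrite rmorphN /= shift_qgen // /conv -sumrN; apply: eq_bigr => i _.
  by rewrite /A /= polyCN mulNr.
move=> _ _.
by rewrite (sum_rowvec_None (B None)) /B (sum_rowvec_None (A 0%N)) /A rmorph0.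
Qed.

Lemma rowform_top (u v : nat -> {poly G}) d e : (forall k, size (u k) <= d.+1)%N ->
    (forall k, size (v k) <= e.+1)%N ->
  (size (rowform u v) <= (d + e).+1)%N /\
  (rowform u v)`_(d + e) = \sum_(a < h.+2) \sum_(b < h.+2)
    (u a)`_d * (v b)`_e * qform (code a) (code b).
Proof.
move=> ud ve; split.
  apply: leq_trans (size_sum _ _ _) _; apply/bigmax_leqP => a _.
  apply: leq_trans (size_sum _ _ _) _; apply/bigmax_leqP => b _.
  rewrite mulrC mul_polyC (leq_trans (size_scale_leq _ _)) //.
  by have [] := coefM_top (ud a) (ve b).
rewrite coef_sum; apply: eq_bigr => a _; rewrite coef_sum; apply: eq_bigr => b _.
by rewrite coefMC; have [_ ->] := coefM_top (ud a) (ve b).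
Qed.

(** The default value of [nth] makes this the part itself for the last part and 0 beyond, so the
    steps add up to [h]. *)
Definition row_step (i : nat) : nat := (nth 0%N lam i - nth 0%N lam i.+1)%N.

Definition reduced_row (i k : nat) : {poly G} :=
  rowvec (x i) k - (if (i < size t)%N then 'X^(row_step i) * rowvec (x i.+1) k else 0).

Definition row_scale (i : nat) : G := if i == size t then 2 else 1.

Lemma lam_desc i : (i < size t)%N -> (nth 0%N lam i.+1 < nth 0%N lam i)%N.
Proof.
move=> i_lt; have /(sortedP 0%N) := lam_sorted; apply; by rewrite /= ltnS.
Qed.

Lemma fpow_size n : (size (fpow G n) <= n.+1)%N.
Proof.
by rewrite /fpow -scaler_nat (leq_trans (size_scale_leq _ _)) // size_polyXn.
Qed.

Lemma coef_fpow n d : (n < d)%N -> (fpow G n)`_d = 0.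
Proof. by move=> nd; rewrite nth_default // (leq_trans (fpow_size n)). Qed.

Lemma xE i : (i <= size t)%N -> x i = Some (nth 0%N lam i).
Proof. by move=> i_le; rewrite /x /rowindex /= ltnS i_le. Qed.

(** The last part has no successor to subtract and keeps the factor 2 of [fcoef], recorded in
    [row_scale]; for the other parts the subtraction leaves the leading term at the next part, which
    is [y i]. *)
Lemma reduced_row_top i k : (size (reduced_row i k) <= (row_step i).+1)%N /\
  (reduced_row i k)`_(row_step i) = row_scale i *+ (code k == y i).
Proof.
rewrite /reduced_row /row_scale /row_step; case: (ltngtP i (size t)) => [i_lt|i_gt|->].
- have ba := lam_desc i_lt; rewrite !xE //; last exact: ltnW.
  rewrite /y rowindex0_lt //=; set a := nth _ _ i in ba *; set b := nth _ t i in ba *.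
  case: k => [|c] /=; first by rewrite mulr0 subrr size_poly0 coef0.
  have -> : (Some c == Some b) = (c == b) by [].
  (* Below [b] both rows carry 2 z^(a-c) and cancel; above [b] the degree stays under a - b; at [b]
     there remains 2 z^(a-b) - z^(a-b). *)
  case: (ltngtP c b) => cb.
  + rewrite (ltnW (ltn_trans cb ba)) /fpow /fcoef.
    rewrite !gtn_eqF ?subn_gt0 //; last exact: ltn_trans ba.
    rewrite mulrnAr -exprD addnBA ?subnK ?(ltnW cb) ?(ltnW ba) //.
    by rewrite subrr size_poly0 coef0.
  + rewrite mulr0 subr0; have [ca|ac] := leqP c a; last by rewrite size_poly0 coef0.
    by rewrite coef_fpow ?(leq_trans (fpow_size _)) //; lia.
  rewrite cb (ltnW ba) subnn /fpow /fcoef /= gtn_eqF ?subn_gt0 //.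
  by rewrite expr0 mulr1 mulr2n addrK size_polyXn coefXn eqxx.
- have xN : x i = None by rewrite /x /rowindex ltnNge i_gt.
  have lamN : nth 0%N lam i = 0%N by rewrite nth_default.
  rewrite xN /y rowindex0_gt // subr0 lamN sub0n.
  by case: k => [|k] /=; rewrite ?size_poly1 ?coef1 ?size_poly0 ?coef0.
rewrite xE // /y rowindex0_eq subr0 [nth _ _ _.+1]nth_default // subn0.
have a_pos : (0 < nth 0%N lam (size t))%N by apply: nth_pos lam_pos _.
case: k => [|c] /=; first by rewrite size_poly0 coef0.
have -> : (Some c == Some 0%N) = (c == 0%N) by [].
have [ca|ac] := leqP c (nth 0%N lam (size t)); last first.
  by rewrite size_poly0 coef0 gtn_eqF // (leq_ltn_trans _ ac).
split; first by rewrite (leq_trans (fpow_size _)) // ltnS leq_subr.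
case: c ca => [|c] ca; last by rewrite coef_fpow ?mulr0n //; lia.
by rewrite subn0 /fpow /fcoef gtn_eqF // coefMn coefXn eqxx.
Qed.

Lemma sum_row_step n : (size t < n)%N -> (\sum_(i < n) row_step i = h)%N.
Proof.
move=> n_gt; have desc i : (nth 0%N lam i.+1 <= nth 0%N lam i)%N.
  case: (ltnP i (size t)) => [/lam_desc/ltnW//|i_ge].
  by rewrite [X in (X <= _)%N]nth_default.
suff sumE k : (\sum_(i < k) row_step i + nth 0%N lam k = h)%N.
  by rewrite -[RHS](sumE n) nth_default ?addn0.
elim: k => [|k IH]; first by rewrite big_ord0.
by rewrite big_ord_recr /= -addnA /row_step subnK.
Qed.

Let x_bounded i : bounded_index (x i).
Proof.
rewrite /x /rowindex; case: ltnP => //= i_lt; rewrite nth_pos //=.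
case: i i_lt => // i; rewrite ltnS /= => i_lt; rewrite ltnW //.
have /allP : all (gtn h) t by have := order_path_min (rev_trans ltn_trans) lam_sorted.
by apply; exact: mem_nth.
Qed.

Let reduce_mx : 'M[{poly G}]_(m.+1.*2) := \matrix_(i, j)
  ((i == j)%:R - (if (j == i.+1 :> nat) && (i < size t)%N then 'X^(row_step i) else 0)).

Lemma det_reduce_mx : \det reduce_mx = 1.
Proof.
rewrite -det_tr det_trig; last first.
  apply/is_trig_mxP => i j ij; rewrite !mxE -val_eqE /= gtn_eqF //.
  by rewrite ltn_eqF ?subr0 // ltnW.
by rewrite big1 // => i _; rewrite !mxE eqxx ltn_eqF //= subr0.
Qed.

Lemma reduce_mx_mul (i : 'I_m.+1.*2) k :
  \sum_(j < m.+1.*2) reduce_mx i j * rowvec (x j) k = reduced_row i k.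
Proof.
under eq_bigr => j _ do rewrite mxE mulrBl.
rewrite sumrB (bigD1 i) //= eqxx mul1r big1 ?addr0 => [|j /negPf]; last first.
  by rewrite eq_sym => ->; rewrite mul0r.
congr (_ - _); case: ifP => [i_lt|_]; last first.
  by rewrite big1 // => j _; rewrite andbF mul0r.
have Si_lt : (i.+1 < m.*2.+2)%N.
  apply: leq_ltn_trans i_lt _; rewrite /m; lia.
rewrite (bigD1 (Ordinal Si_lt : 'I_m.+1.*2)) //= eqxx big1 ?addr0 // => j.
by rewrite -val_eqE /= => /negPf ->; rewrite mul0r.
Qed.

Lemma reduce_mx_congr : reduce_mx *m map_mx D (qmatrix m.+1 x) *m reduce_mx^T =
  \matrix_(i, j) rowform (reduced_row i) (reduced_row j).
Proof.
have shiftE i j : map_mx D (qmatrix m.+1 x) i j = rowform (rowvec (x i)) (rowvec (x j)).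
  by rewrite mxE mxE shift_qform.
apply/matrixP=> i j; rewrite mxE [RHS]mxE /rowform.
transitivity (\sum_(j' < m.+1.*2) \sum_(i' < m.+1.*2) \sum_(a < h.+2) \sum_(b < h.+2)
  (reduce_mx i i' * rowvec (x i') a) * (reduce_mx j j' * rowvec (x j') b) *
  (qform (code a) (code b))%:P).
  apply: eq_bigr => j' _; rewrite mxE [X in _ * X]mxE big_distrl.
  apply: eq_bigr => i' _ /=; rewrite shiftE.
  rewrite /rowform mulrAC big_distrr /=; apply: eq_bigr => a _.
  rewrite big_distrr; apply: eq_bigr => b _ /=; ring.
under eq_bigr => j' _ do rewrite exchange_big /=.
rewrite exchange_big; apply: eq_bigr => a _ /=.
under eq_bigr => j' _ do rewrite exchange_big /=.
rewrite exchange_big; apply: eq_bigr => b _ /=.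
under eq_bigr => j' _ do rewrite -big_distrl -big_distrl /= reduce_mx_mul mulrAC.
rewrite -!mulrA -big_distrr /=.
by rewrite reduce_mx_mul; ring.
Qed.

Let y_code i : {k : 'I_h.+2 | y i = code k}.
Proof.
have t_lt : all (gtn h) t by exact: order_path_min (rev_trans ltn_trans) lam_sorted.
rewrite /y; case: (ltngtP i (size t)) => [i_lt|i_gt|->].
- have lt : (nth 0%N t i < h)%N by apply: (all_nthP 0%N t_lt).
  by exists (Ordinal (ltnW lt : (nth 0%N t i).+1 < h.+2)%N); rewrite rowindex0_lt.
- by exists ord0; rewrite rowindex0_gt.
by exists (Ordinal (isT : 1 < h.+2)%N); rewrite rowindex0_eq.
Qed.

Lemma rowform_reduced_top (i j : nat) :
  (size (rowform (reduced_row i) (reduced_row j)) <= (row_step i + row_step j).+1)%N /\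
  (rowform (reduced_row i) (reduced_row j))`_(row_step i + row_step j) =
    row_scale i * row_scale j * qform (y i) (y j).
Proof.
have top i' k := (reduced_row_top i' k).1.
have [sz ->] := rowform_top (top i) (top j); split=> //.
have [[a ya] [b yb]] := (y_code i, y_code j).
have codeE (k k' : 'I_h.+2) : (code k == code k') = (k == k').
  by case: k k' => [[|k] ?] [[|k'] ?].
rewrite (bigD1 a) //= (bigD1 b) //= !(reduced_row_top _ _).2 ya yb !eqxx.
rewrite big1 ?addr0 => [|b' /negPf ne]; last first.
  by rewrite !(reduced_row_top _ _).2 yb codeE ne mulr0 mul0r.
rewrite big1 ?addr0 // => a' /negPf ne; rewrite big1 // => b' _.
by rewrite !(reduced_row_top _ _).2 ya codeE ne !mul0r.
Qed.

Lemma pfsum_scale n (c : 'I_n.*2 -> G) (A : 'M[G]_(n.*2)) :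
  pfsum (\matrix_(i, j) (c i * c j * A i j)) = \prod_i c i * pfsum A.
Proof.
rewrite big_distrr; apply: eq_bigr => s _ /=; rewrite mulrCA; congr (_ * _).
rewrite [\prod_i c i](reindex_perm s) big_ord_pairs -big_split /=.
by apply: eq_bigr => i _; rewrite mxE.
Qed.

(** The row reduction is a congruence of determinant 1. Its steps telescope to [h], which bounds the
    degree; the coefficient in degree [h] is the Pfaffian along [y] times the single factor 2 from
    [row_scale]. *)
Lemma shift_qschur_top r : (h <= r)%N ->
  (D (qschur p lam))`_r = if r == h then 2 * qschur p t else 0.
Proof.
move=> hr; have t_pos : 0%N \notin t.
  by move: lam_pos; rewrite inE negb_or => /andP[].
have -> : qschur p lam = qpf p m.+1 x by [].
rewrite /qpf DZ coefCM -scalerAl mul1r rmorph_pfsum.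
have -> : pfsum (map_mx D (qmatrix m.+1 x)) =
    pfsum (\matrix_(i < m.+1.*2, j < m.+1.*2)
      rowform (reduced_row i) (reduced_row j)).
  by rewrite -reduce_mx_congr pfsum_congr det_reduce_mx mul1r.
have size_t : (size t < m.+1.*2)%N by rewrite /m; lia.
pose A : 'M[{poly G}]_(m.+1.*2) :=
  \matrix_(i, j) rowform (reduced_row i) (reduced_row j).
have [] := @coef_pfsum_top _ _ A (fun i => row_step i).
  by move=> i j; rewrite mxE; have [] := rowform_reduced_top i j.
rewrite sum_row_step // => sizeA coefA.
case: eqP hr => [->|/eqP rh] hr; last first.
  by rewrite nth_default ?scaler0 // (leq_trans sizeA) // ltn_neqAle eq_sym rh.
rewrite coefA -(qpf_tail p t_pos) /qpf -scalerAr; congr (_ *: _).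
have -> : \matrix_(i, j) (A i j)`_(row_step i + row_step j) =
    \matrix_(i, j) (row_scale i * row_scale j * (qmatrix m.+1 y) i j).
  apply/matrixP=> i j; rewrite mxE [RHS]mxE [A i j]mxE [qmatrix _ _ _ _]mxE.
  by have [] := rowform_reduced_top i j.
rewrite pfsum_scale; congr (_ * _).
rewrite (bigD1 (Ordinal size_t)) //= big1 ?mulr1 => [|i].
  by rewrite /row_scale eqxx.
by rewrite -val_eqE /row_scale /= => /negPf ->.
Qed.

End TopShift.

(** * Orthogonality *)

Section Orthogonality.
Variables (G : comAlgType rat) (p : nat -> G).
Variables (D : {rmorphism G -> {poly G}}) (pair : G -> G -> rat).
Hypothesis DZ : forall (c : rat) g, D (c *: g) = (c *: 1)%:P * D g.
Hypothesis Dp : forall n, odd n -> D (p n) = (p n)%:P + 'X^n.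
Hypothesis pairC : forall g h, pair g h = pair h g.
Hypothesis pair_lin : forall h, linear_for *%R (pair h).
Hypothesis pair11 : pair 1 1 = 1.
Hypothesis pair_qgen : forall r g h, pair (qgen p r * g) h = pair g (D h)`_r.

HB.instance Definition _ h :=
  GRing.isLinear.Build rat G rat *%R (pair h) (pair_lin h).

Lemma qschur_nil : qschur p [::] = 1.
Proof.
rewrite /qschur /qpf expn0 fact0 invr1 scale1r /pfsum.
rewrite (big_pred1 1%g) => [|s]; first by rewrite odd_perm1 mul1r big_ord0.
by apply/esym/eqP/permP => -[].
Qed.

Definition strict_seq (s : seq nat) : bool := sorted gtn s && (0%N \notin s).

Lemma strict_seq_behead a s : strict_seq (a :: s) -> strict_seq s.
Proof.
move=> /andP[/path_sorted s_sorted]; rewrite inE negb_or => /andP[_ s_pos].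
exact/andP.
Qed.

(** Extends [shift_qschur_top] to the empty sequence; there the coefficient in degree 0 is 1 and not
    2, hence the condition on [r]. *)
Lemma coef_shift_qschur r s : strict_seq s -> (0 < r)%N -> (head 0 s <= r)%N ->
  (D (qschur p s))`_r = if r == head 0%N s then 2 * qschur p (behead s) else 0.
Proof.
case: s => [_ r_gt0 _|a s] /=.
  by rewrite qschur_nil rmorph1 coef1 gtn_eqF.
by case/andP=> s_sorted s_pos _; apply: shift_qschur_top.
Qed.

(** Induction on the total length, with the larger first part in [s] by symmetry. Expanding Q_s
    along its first row and moving each q_r across leaves coefficients of D Q_t in degrees at or
    above the first part of [t]. *)
Lemma qschur_orthogonal s t : strict_seq s -> strict_seq t ->
  pair (qschur p s) (qschur p t) = if s == t then 2 ^+ size s else 0.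
Proof.
have [n] := ubnP (size s + size t)%N; elim: n s t => // n IH s t lt_n s_strict t_strict.
wlog le_ts : s t lt_n s_strict t_strict / (head 0 t <= head 0 s)%N => [wl|].
  case: (leqP (head 0%N t) (head 0%N s)) => [/wl|/ltnW le_st]; first exact.
  rewrite pairC wl // 1?addnC // eq_sym; by case: eqP => // ->.
case: s s_strict le_ts lt_n => [|h s] s_strict le_ts lt_n.
  case: t t_strict le_ts {lt_n} => [|a t]; first by rewrite qschur_nil pair11.
  by case/andP=> _; rewrite inE negb_or /= leqn0 eq_sym => /andP[/negPf ->].
have [/andP[s_sorted hs_pos]] := (s_strict).
have /andP[h_pos s_pos] : (0 < h)%N && (0%N \notin s).
  by move: hs_pos; rewrite inE negb_or eq_sym -lt0n.
have s_lt : all (fun b => b < h)%N s.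
  exact: order_path_min (rev_trans ltn_trans) s_sorted.
have [X ->] := qschur_cons p s_pos s_lt.
rewrite pairC linearD linear_sum /= big1 ?addr0 => [|k _]; last first.
  have lt_hk : (head 0 t < h + k.+1)%N.
    by rewrite addnS ltnS (leq_trans le_ts) // leq_addr.
  rewrite pairC pair_qgen coef_shift_qschur ?(ltnW lt_hk) ?addnS // -addnS.
  by rewrite gtn_eqF // linear0.
rewrite pairC pair_qgen coef_shift_qschur //=.
case: t t_strict le_ts lt_n => [|a t] t_strict le_ts lt_n /=.
  by rewrite gtn_eqF // linear0.
rewrite eqseq_cons; case: eqP => [_|] /=; last by rewrite linear0.
rewrite mulr_natl linearMn /= IH; first last.
- exact: strict_seq_behead t_strict.
- exact: strict_seq_behead s_strict.
- by move: lt_n => /=; lia.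
by case: eqP => _; rewrite ?mul0rn // exprS mulr_natl.
Qed.

End Orthogonality.

(** * The scalar product on power sums *)

Section Generators.
Variable R : comNzRingType.

Lemma psumE k : psum R k.*2.+1 = mkmalgU (ucm k) 1.
Proof. by rewrite /psum /= uphalf_double. Qed.

Lemma monomM (m1 m2 : {cmonom nat}) :
  mkmalgU (mmul m1 m2) 1 = mkmalgU m1 1 * mkmalgU m2 1 :> Gamma R.
Proof. by rewrite [RHS]malgM_def fgmulUU mulr1. Qed.

Lemma malgZU (m : {cmonom nat}) (c : R) :
  c *: mkmalgU m 1 = mkmalgU m c :> Gamma R.
Proof.
apply/malgP=> k; rewrite mcoeffZ [RHS]mcoeffU [X in _ * X]mcoeffU.
by rewrite mulr_natr.
Qed.

Lemma malg_sumZ (g : Gamma R) :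
  g = \sum_(m <- msupp g) g@_m *: mkmalgU m 1.
Proof. by rewrite [LHS]monalgE; apply: eq_bigr => m _; rewrite [RHS]malgZU. Qed.

Lemma cmonom_ind (P : {cmonom nat} -> Prop) :
  P mone -> (forall k m, P m -> P (mmul (ucm k) m)) -> forall m, P m.
Proof.
move=> P1 PM m; have [n] := ubnP (mdeg m).
elim: n m => // n IHn m lt_mn.
have [->//|m_neq1] := eqVneq m mone.
have [k mk] : exists k, m k != 0%N.
  have /fset0Pn[k] : finsupp m != fset0.
    apply: contra m_neq1 => /eqP m0; apply/cmP=> i; rewrite cm1.
    by apply/eqP; rewrite cmE_eq0 m0 inE.
  by rewrite -cmE_neq0; exists k.
have mE : m = mmul (ucm k) (divcm m (ucm k)).
  apply/eqP/cmP=> i; rewrite cmM divcmE ucmE.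
  by case: eqP => [<-|_]; rewrite ?subn0 ?subnKC // lt0n.
rewrite mE; apply/PM/IHn; move: lt_mn.
by rewrite [in mdeg m]mE mdegM mdegU ltnS.
Qed.

Lemma Gamma_ind (P : Gamma R -> Prop) :
    P 1 -> (forall a g h, P g -> P h -> P (a *: g + h)) ->
    (forall k g, P g -> P (psum R k.*2.+1 * g)) ->
  forall g, P g.
Proof.
move=> P1 PD PM g.
have P0 : P 0 by rewrite -(addNr (1 : Gamma R)) -scaleN1r; apply: PD.
have Pmon m : P (mkmalgU m 1).
  by elim/cmonom_ind: m => [//|k m Pm]; rewrite monomM -psumE; apply: PM.
rewrite [g]malg_sumZ; elim/big_rec: _ => [//|m h _ Ph].
exact: (PD g@_m _ _ (Pmon m) Ph).
Qed.

End Generators.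

Section Pairing.

(** For the monomial p_alpha this is 2^(-l(alpha)) z_alpha, since [m k] is the multiplicity of the
    part 2k + 1. *)
Definition mono_norm (m : {cmonom nat}) : rat :=
  \prod_(k <- finsupp m) (((k.*2.+1)%:R / 2) ^+ m k * (m k)`!%:R).

Lemma mono_normEw (E : {fset nat}) (m : {cmonom nat}) : (finsupp m `<=` E)%fset ->
  mono_norm m = \prod_(k <- E) (((k.*2.+1)%:R / 2) ^+ m k * (m k)`!%:R).
Proof.
move=> le; rewrite /mono_norm (big_fset_incl _ le) // => k _ /fsfun_dflt ->.
by rewrite expr0 mulr1.
Qed.

Lemma mono_norm1 : mono_norm mone = 1.
Proof. by rewrite /mono_norm mdom1 big_nil. Qed.

Lemma mono_normMu k m : mono_norm (mmul (ucm k) m) =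
  (k.*2.+1)%:R / 2 * (m k).+1%:R * mono_norm m.
Proof.
have le1 : (finsupp (mmul (ucm k) m) `<=` k |` finsupp m)%fset.
  by rewrite mdomD mdomU.
rewrite (mono_normEw le1) (mono_normEw (fsubsetU1 k _)).
rewrite [LHS](big_fsetD1 k) ?fset1U1 //=.
rewrite [in RHS](big_fsetD1 k) ?fset1U1 //= cmM cmUU exprS factS natrM.
rewrite [RHS]mulrA; congr (_ * _).
  by rewrite mulrACA.
apply: eq_big_seq => j; rewrite !inE => /andP[jk _]; rewrite cmM cmU eq_sym.
by rewrite (negPf jk).
Qed.

Definition gpair (g h : Gamma rat) : rat :=
  \sum_(m <- msupp g) mono_norm m * (g@_m * h@_m).

Lemma gpairEw (E : {fset {cmonom nat}}) (g h : Gamma rat) : (msupp g `<=` E)%fset ->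
  gpair g h = \sum_(m <- E) mono_norm m * (g@_m * h@_m).
Proof.
move=> le; rewrite /gpair (big_fset_incl _ le) // => m _ /mcoeff_outdom ->.
by rewrite mul0r mulr0.
Qed.

Lemma gpairC g h : gpair g h = gpair h g.
Proof.
rewrite (gpairEw _ (fsubsetUl _ (msupp h))).
rewrite (gpairEw _ (fsubsetUr (msupp g) _)).
by apply: eq_bigr => m _; rewrite [g@__ * _]mulrC.
Qed.

Lemma gpair_linear h : linear_for *%R (gpair h).
Proof.
move=> a g1 g2; rewrite /gpair big_distrr -big_split /=.
apply: eq_bigr => m _; rewrite mcoeffD mcoeffZ !mulrDr; congr (_ + _).
by rewrite (mulrCA _ a) (mulrCA _ a).
Qed.

HB.instance Definition _ h :=
  GRing.isLinear.Build rat (Gamma rat) rat *%R (gpair h) (gpair_linear h).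

Lemma gpair_mono m h : gpair (mkmalgU m 1) h = mono_norm m * h@_m.
Proof.
rewrite (gpairEw _ msuppU_le) big_seq_fset1 mcoeffUU mul1r //.
Qed.

End Pairing.

Definition gconst : {rmorphism rat -> Gamma rat} := malgC.

Definition pconst : {rmorphism rat -> {poly Gamma rat}} := polyC \o gconst.

Lemma gsubstZ (R S : comNzRingType) (f : {rmorphism R -> S}) v c g :
  gsubst f v (c *: g) = f c * gsubst f v g.
Proof. exact: mmapZ. Qed.

(** Supplies both the shift [D] and the infinitesimal substitutions that define the partial
    derivatives. *)
Lemma poly_subst_exists (v : nat -> {poly Gamma rat}) :
  {E : {rmorphism Gamma rat -> {poly Gamma rat}} |
    (forall k, E (psum rat k.*2.+1) = v k) /\
    (forall c g, E (c *: g) = (c *: 1)%:P * E g)}.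
Proof.
exists (gsubst pconst v : {rmorphism Gamma rat -> {poly Gamma rat}}).
split=> [k|c g] /=; first by rewrite gsubst_psum /= uphalf_double.
by rewrite gsubstZ /= -mul_malgC mulr1.
Qed.

Section DualNumbers.
Variables (G : comAlgType rat) (E : {rmorphism G -> {poly G}}).
Hypothesis EZ : forall (c : rat) g, E (c *: g) = (c *: 1)%:P * E g.
Hypothesis E_coef0 : forall g, (E g)`_0 = g.

(** Modulo the square of the variable, [E] is a ring morphism g |-> g + d(g) X, so d is a
    derivation. *)
Lemma derivation_of_subst : {d : {linear G -> G} |
  (forall g, d g = (E g)`_1) & forall g h, d (g * h) = d g * h + g * d h}.
Proof.
pose d g := (E g)`_1.
have d_lin : linear d.
  by move=> a g h; rewrite /d rmorphD /= coefD EZ coefCM -scalerAl mul1r.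
pose m := GRing.isLinear.Build rat G G *:%R d d_lin.
pose d' : {linear G -> G} := HB.pack d m.
exists d' => //= g h.
by rewrite /d rmorphM /= coefM !big_ord_recl big_ord0 /= addr0 !E_coef0 addrC.
Qed.

End DualNumbers.

(** The partial derivative by the variable [k], read off from the substitution that adds ['X] to
    this variable alone. *)
Lemma dpsum_exists k : {d : {linear Gamma rat -> Gamma rat} |
  (forall j, d (psum rat j.*2.+1) = (j == k)%:R) &
  forall g h, d (g * h) = d g * h + g * d h}.
Proof.
have [E [Ep EZ]] := poly_subst_exists
  (fun j => (psum rat j.*2.+1)%:P + 'X *+ (j == k)).
have E0 g : (E g)`_0 = g.
  elim/Gamma_ind: g => [|a g h IHg IHh|j g IHg].
  - by rewrite rmorph1 coef1.
  - by rewrite rmorphD /= coefD EZ coefCM IHg IHh -scalerAl mul1r.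
  by rewrite rmorphM /= coef0M IHg Ep coefD coefC coefMn coefX mul0rn addr0.
have [d dE dM] := derivation_of_subst EZ E0.
by exists d => // j; rewrite dE Ep coefD coefC coefMn coefX add0r.
Qed.

Section Coefficients.
Variable R : comNzRingType.
Implicit Types (g h : Gamma R) (m : {cmonom nat}).

Lemma mcoeff_psum_mono k m m' :
  (psum R k.*2.+1 * mkmalgU m' 1)@_m = (mmul (ucm k) m' == m)%:R.
Proof. by rewrite psumE -monomM [LHS]mcoeffU. Qed.

Lemma mcoeff_psumM k h m : (psum R k.*2.+1 * h)@_(mmul (ucm k) m) = h@_m.
Proof.
rewrite [h]malg_sumZ mulr_sumr [LHS]raddf_sum [RHS]raddf_sum /=.
apply: eq_bigr => m' _; move: (h@_m') => a; rewrite -scalerAr.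
rewrite [LHS]mcoeffZ [RHS]mcoeffZ [X in _ * X]mcoeff_psum_mono.
rewrite [X in _ = _ * X]mcoeffU; congr (_ * _%:R); congr nat_of_bool.
apply/eqP/eqP => [e|->//]; apply/eqP/cmP => i.
by have := congr1 (fun x : {cmonom nat} => x i) e; rewrite !cmM => /addnI.
Qed.

Lemma mcoeff_psumM0 k h m : m k = 0%N -> (psum R k.*2.+1 * h)@_m = 0.
Proof.
move=> mk; rewrite [h]malg_sumZ mulr_sumr [LHS]raddf_sum big1 //= => m' _.
rewrite -scalerAr [LHS]mcoeffZ [X in _ * X]mcoeff_psum_mono.
by case: eqP => [e|_]; [move: mk; rewrite -e cmM cmUU|rewrite mulr0].
Qed.

Variant ucm_spec k m : Prop :=
| UcmZero of m k = 0%N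
| UcmMul m' of m = mmul (ucm k) m'.

Lemma ucmP k m : ucm_spec k m.
Proof.
have [m0|mk] := eqVneq (m k) 0%N; first exact: UcmZero.
apply: (@UcmMul _ _ (divcm m (ucm k))); apply/eqP/cmP=> i; rewrite cmM divcmE ucmE.
by case: eqP => [<-|_]; rewrite ?subn0 ?subnKC // lt0n.
Qed.

End Coefficients.

(** Differentiation lowers the exponent of the variable [k] by one and multiplies by the old
    exponent, here [(m k).+1]. *)
Lemma mcoeff_dpsum k (d : {linear Gamma rat -> Gamma rat}) :
    (forall j, d (psum rat j.*2.+1) = (j == k)%:R) ->
    (forall g h, d (g * h) = d g * h + g * d h) ->
  forall g m, (d g)@_m = (m k).+1%:R * g@_(mmul (ucm k) m).
Proof.
move=> dp dM; have d1 : d 1 = 0.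
  by have /eqP := dM 1 1; rewrite !mul1r mulr1 -subr_eq0 opprD addrA subrr sub0r
    oppr_eq0 => /eqP.
have dpM j g : d (psum rat j.*2.+1 * g) =
    (if j == k then g else 0) + psum rat j.*2.+1 * d g.
  rewrite dM dp; congr (_ + _).
  by case: (j == k); [exact: mul1r|exact: mul0r].
elim/Gamma_ind=> [|a g h IHg IHh|j g IHg] m.
- by rewrite d1 mcoeff0 mcoeff1 cmM_eq1 cm1_eq1 mulr0.
- rewrite linearP !mcoeffD !mcoeffZ IHg IHh mulrDr; congr (_ + _).
  by rewrite mulrCA.
rewrite dpM mcoeffD; have [->|jk] := eqVneq j k.
  rewrite [X in _ = _ * X]mcoeff_psumM.
  case: (ucmP k m) => [mk|m' ->].
    by rewrite mk [X in _ + X]mcoeff_psumM0 // addr0 mul1r.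
  rewrite [X in _ + X]mcoeff_psumM IHg cmM cmUU.
  by rewrite add1n -[in RHS]natr1 mulrDl [1 * _]mul1r addrC.
rewrite mcoeff0 add0r; case: (ucmP j m) => [mj|m' ->].
  rewrite [LHS]mcoeff_psumM0 // [X in _ * X]mcoeff_psumM0 ?mulr0 //.
  by rewrite cmM cmU mj eq_sym (negPf jk).
rewrite [LHS]mcoeff_psumM mulmA (mulmC (ucm k)) -mulmA.
by rewrite [X in _ * X]mcoeff_psumM IHg cmM cmU (negPf jk).
Qed.

(** On monomials the factor [(m k).+1] of [mono_normMu] is the one that differentiation produces;
    bilinearity does the rest. *)
Lemma gpair_psum k (d : {linear Gamma rat -> Gamma rat}) :
    (forall j, d (psum rat j.*2.+1) = (j == k)%:R) ->
    (forall g h, d (g * h) = d g * h + g * d h) ->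
  forall g h, gpair (psum rat k.*2.+1 * g) h =
    (k.*2.+1)%:R / 2 * gpair g (d h).
Proof.
move=> dp dM g h.
have mono m : gpair h (psum rat k.*2.+1 * mkmalgU m 1) =
    (k.*2.+1)%:R / 2 * gpair (d h) (mkmalgU m 1).
  rewrite psumE -monomM [LHS]gpairC [X in _ = _ * X]gpairC [LHS]gpair_mono.
  rewrite [X in _ = _ * X]gpair_mono mono_normMu (mcoeff_dpsum dp dM).
  by rewrite !mulrA [_ * mono_norm m * _]mulrAC.
rewrite [g]malg_sumZ mulr_sumr [LHS]gpairC raddf_sum /=.
rewrite [X in _ = _ * X]gpairC raddf_sum big_distrr /=; apply: eq_bigr => m _.
move: (g@_m) => a; rewrite -scalerAr [LHS]linearZ [X in _ = _ * X]linearZ /=.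
by rewrite mono mulrCA.
Qed.

Lemma qfun2E r s : qfun2 r s = qtwo (psum rat) r s.
Proof. by []. Qed.

(** The parts decrease, so [i < j] selects the first branch of [qanti]. For odd length the default
    part 0 of [schurQ] corresponds to oo, by [qtwo0]. *)
Lemma schurQE s : strict_seq s -> schurQ s = qschur (psum rat) s.
Proof.
case/andP=> s_sorted s_pos.
have s_desc i j : (i < j)%N -> (i < size s)%N -> (nth 0%N s j < nth 0%N s i)%N.
  move=> ij i_lt; case: (ltnP j (size s)) => [j_lt|j_ge].
    exact: (sorted_ltn_nth (rev_trans ltn_trans) 0%N s_sorted).
  by rewrite [nth 0%N s j]nth_default // nth_pos.
have qformE (i j : 'I_(uphalf (size s)).*2) : (i < j)%N ->
    qform (psum rat) (rowindex s i) (rowindex s j) =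
    qfun2 (nth 0%N s i) (nth 0%N s j).
  move=> ij; have j_lt := ltn_ord j.
  have i_lt : (i < size s)%N.
    by rewrite (leq_trans ij) // -ltnS (leq_trans j_lt) //; lia.
  rewrite qfun2E /rowindex i_lt; case: ltnP => [_|j_ge] /=.
    by rewrite /qanti s_desc.
  by rewrite [nth 0%N s j]nth_default // qtwo0.
rewrite /schurQ /pfaffian /qschur /qpf; congr (_ *: pfsum _).
apply/matrixP=> i j; rewrite [LHS]mxE [RHS]mxE.
case: (ltngtP i j) => [ij|ji|/val_inj ->].
- by rewrite qformE.
- by rewrite qformC qformE.
by rewrite qformxx.
Qed.

Lemma schurQ_orthogonal s t : strict_seq s -> strict_seq t ->
  gpair (schurQ s) (schurQ t) = if s == t then 2 ^+ size s else 0.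
Proof.
move=> s_strict t_strict; rewrite !schurQE //.
have [D [Dp DZ]] := poly_subst_exists (fun k => (psum rat k.*2.+1)%:P + 'X^(k.*2.+1)).
pose d n := s2val (dpsum_exists n./2).
have dp n : forall j, d n (psum rat j.*2.+1) = (j == n./2)%:R.
  exact: s2valP (dpsum_exists n./2).
have dM n : forall g h, d n (g * h) = d n g * h + g * d n h.
  exact: s2valP' (dpsum_exists n./2).
have oddE n : odd n -> n = n./2.*2.+1 by move/odd_half_doubleS.
have Dp' n : odd n -> D (psum rat n) = (psum rat n)%:P + 'X^n.
  by move/oddE=> nE; rewrite nE Dp.
apply: (@qschur_orthogonal _ _ D) => //.
- exact: gpairC.
- exact: gpair_linear.
- by rewrite [X in gpair X]/(GRing.one _) gpair_mono mono_norm1 mcoeff1 eqxx mulr1.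
move=> r g h; apply: (@pair_qgen _ _ _ D d) => //.
- move=> P P1 PD PM; apply: Gamma_ind => // k g' Pg; apply: PM => //=.
  by rewrite odd_double.
- move=> n m' odd_n odd_m; rewrite [m' in psum _ m']oddE // dp.
  suff -> : (m' == n) = (m'./2 == n./2) by [].
  by apply/eqP/eqP => [->//|e]; rewrite (oddE m') // e -oddE.
- exact: gpairC.
- exact: gpair_linear.
move=> n g' h' odd_n; rewrite [n in psum _ n]oddE // (gpair_psum (dp n) (dM n)).
by rewrite -oddE.
Qed.

(** * Products of odd power sums as monomials *)

Definition ppart_mono (al : seq nat) : {cmonom nat} :=
  \big[mmul/mone]_(a <- al) ucm a./2.

Lemma ppartE (R : comNzRingType) al : ppart R al = mkmalgU (ppart_mono al) 1.
Proof.
rewrite /ppart /ppart_mono; elim: al => [|a al IH]; first by rewrite !big_nil.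
by rewrite !big_cons monomM IH.
Qed.

Lemma ppart_monoE al k : all odd al -> ppart_mono al k = count_mem k.*2.+1 al.
Proof.
rewrite /ppart_mono; elim: al => [|a al IH] /=; first by rewrite big_nil cm1.
case/andP=> odd_a /IH kE; rewrite big_cons cmM cmU kE; congr (_ + _)%N.
congr nat_of_bool; apply/eqP/eqP => [<-|->]; first by rewrite odd_half_doubleS.
by rewrite /= uphalf_double.
Qed.

(** The exponents are the multiplicities of the odd parts, and a sorted sequence is determined by
    its multiplicities. *)
Lemma ppart_mono_inj N (al be : part N) : al \in OP N -> be \in OP N ->
  ppart_mono al = ppart_mono be -> al = be.
Proof.
rewrite !inE => al_odd be_odd eq_mono; apply: val_inj => /=.
have [/and3P[al_sorted _ _] /and3P[be_sorted _ _]] := (partsP al, partsP be).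
apply: (sorted_eq (rev_trans leq_trans) _ al_sorted be_sorted) => [a b|].
  by rewrite andbC -eqn_leq => /eqP.
apply/allP=> a _ /=; apply/eqP; have [odd_a|even_a] := boolP (odd a).
  have kE (ga : part N) : all odd ga -> count_mem a ga = ppart_mono ga a./2.
    by move=> /(ppart_monoE a./2) ->; rewrite odd_half_doubleS.
  by rewrite !kE // eq_mono.
have k0 (ga : part N) : all odd ga -> count_mem a ga = 0%N.
  move=> ga_odd; apply/count_memPn; apply: contra even_a; exact: allP.
by rewrite !k0.
Qed.

Lemma zpart_cons a al : zpart (a :: al) = (a * (count_mem a al).+1 * zpart al)%N.
Proof.
(* Both products are taken over one common list of parts; an extra part contributes r^0 0! = 1. *)
have zpartEw be s : uniq s -> {subset be <= s} -> zpart be =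
    (\prod_(r <- s) (r ^ count_mem r be * (count_mem r be)`!))%N.
  move=> uniq_s sub; rewrite /zpart [RHS](bigID (fun r => r \in be)) /=.
  rewrite [X in (_ * X)%N]big1 ?muln1 => [|r r_be]; last by rewrite (count_memPn r_be).
  rewrite -[RHS]big_filter; apply: perm_big; apply: uniq_perm;
    rewrite ?undup_uniq ?filter_uniq //.
  by move=> r; rewrite mem_undup mem_filter; case: (boolP (r \in be)) => // /sub ->.
pose s := undup (a :: al).
have a_s : a \in s by rewrite mem_undup mem_head.
rewrite (zpartEw _ s) ?undup_uniq //; last by move=> r; rewrite mem_undup.
rewrite (zpartEw al s) ?undup_uniq //; last first.
  by move=> r r_al; rewrite mem_undup inE r_al orbT.
rewrite !(bigD1_seq a a_s) ?undup_uniq //= eqxx add1n expnS factS [RHS]mulnA.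
congr (_ * _)%N; first by rewrite mulnACA.
by apply: eq_bigr => r /negPf ra; rewrite eq_sym ra.
Qed.

Lemma mono_norm_ppart al : all odd al ->
  mono_norm (ppart_mono al) = (zpart al)%:R / 2 ^+ size al.
Proof.
elim: al => [_|a al IH] /=.
  by rewrite /ppart_mono big_nil mono_norm1 /zpart big_nil expr0 divr1.
case/andP=> odd_a odd_al; rewrite /ppart_mono big_cons -/(ppart_mono al).
rewrite mono_normMu IH // ppart_monoE // odd_half_doubleS // zpart_cons.
rewrite !natrM exprS; field; exact: expf_neq0.
Qed.

Lemma zpart_gt0 al : 0%N \notin al -> (0 < zpart al)%N.
Proof.
elim: al => [|a al IH]; first by rewrite /zpart big_nil.
by rewrite inE negb_or eq_sym -lt0n zpart_cons !muln_gt0 => /andP[-> /IH ->].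
Qed.

Lemma gpair_ppart N (al be : part N) : al \in OP N -> be \in OP N ->
  gpair (ppart rat al) (ppart rat be) =
    if al == be then (zpart al)%:R / 2 ^+ size al else 0.
Proof.
move=> al_odd be_odd; rewrite !ppartE gpair_mono.
rewrite mono_norm_ppart; last by move: al_odd; rewrite inE.
rewrite [X in _ * X]mcoeffU; case: (al =P be) => [->|al_be]; first by rewrite eqxx mulr1.
by case: eqP => [/(ppart_mono_inj be_odd al_odd)/esym//|_]; rewrite mulr0.
Qed.

(** * Comparison of power-sum coefficients and the final formula *)

Lemma mcoeff_ppart (R : comNzRingType) N (al be : part N) :
  al \in OP N -> be \in OP N ->
  (ppart R be)@_(ppart_mono al) = (be == al)%:R.
Proof.
move=> al_odd be_odd; rewrite ppartE [LHS]mcoeffU.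
by congr (_%:R); congr nat_of_bool; apply/eqP/eqP => [/ppart_mono_inj->|->].
Qed.

Lemma mcoeff_ppart_sum (R : comNzRingType) N (f : part N -> R) al :
  al \in OP N ->
  (\sum_(be in OP N) f be *: ppart R be)@_(ppart_mono al) = f al.
Proof.
move=> al_odd; rewrite [LHS]raddf_sum.
transitivity (\sum_(be in OP N) f be * (be == al)%:R).
  by apply: eq_bigr => be be_odd; rewrite /= mcoeffZ mcoeff_ppart.
rewrite (bigD1 al) //= eqxx mulr1 big1 ?addr0 // => be /andP[_ /negPf ->].
by rewrite mulr0.
Qed.

Lemma ppart_coef_eq (R : comNzRingType) N (a b : part N -> R)
    (M : part N -> part N -> R) :
    \sum_(al in OP N) a al *: ppart R al =
      \sum_(nu in SP N) b nu *: \sum_(al in OP N) M nu al *: ppart R al ->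
  forall al, al \in OP N -> a al = \sum_(nu in SP N) b nu * M nu al.
Proof.
move=> eq_sum al al_odd; rewrite -(mcoeff_ppart_sum a al_odd) [X in X@__]eq_sum.
rewrite [LHS]raddf_sum; apply: eq_bigr => nu _; rewrite /= mcoeffZ.
by congr (_ * _); exact: mcoeff_ppart_sum.
Qed.

(** When the last hypothesis is multiplied by [chi mu al] and summed over [al], orthogonality
    isolates [C lam mu] times 2^n. *)
Lemma extract_coef (K : fieldType) (f : {rmorphism rat -> K}) (N n : nat)
    (lam mu : part N) (d chi : part N -> part N -> rat)
    (C : part N -> part N -> K) (r : seq nat -> K) :
    mu \in SP N ->
    (forall nu, nu \in SP N -> \sum_(al in OP N) d nu al * chi nu al * chi mu al =
      if nu == mu then 2 ^+ n else 0) ->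
    (forall al, al \in OP N -> f (d lam al * chi lam al) * r (parts al) =
      \sum_(nu in SP N) C lam nu * f (d nu al * chi nu al)) ->
  C lam mu = 2 ^- n * \sum_(al in OP N)
    f (d lam al * chi lam al * chi mu al) * r (parts al).
Proof.
move=> mu_SP orth key.
have two_neq0 : 2 ^+ n != 0 :> K.
  by rewrite -(rmorph_nat f) -rmorphXn fmorph_eq0 expf_neq0.
apply: (mulfI two_neq0); rewrite mulVKf //.
transitivity (\sum_(nu in SP N) C lam nu *
    f (\sum_(al in OP N) d nu al * chi nu al * chi mu al)).
  rewrite (bigD1 mu) //= orth // eqxx big1 ?addr0.
    by rewrite mulrC rmorphXn rmorph_nat.
  by move=> nu /andP[nu_SP /negPf ne]; rewrite orth // ne rmorph0 mulr0.
under eq_bigr => nu _ do rewrite rmorph_sum big_distrr /=.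
rewrite exchange_big; apply: eq_bigr => al al_odd /=.
rewrite [in RHS]rmorphM [RHS]mulrAC key // big_distrl /=.
by apply: eq_bigr => nu _; rewrite rmorphM mulrA.
Qed.

Lemma orthogonal_sums (G : lmodType rat) (pair : G -> G -> rat)
    (pairC : forall g h, pair g h = pair h g)
    (pair_lin : forall h, linear_for *%R (pair h))
    (I : finType) (A : {set I}) (e : I -> G) (w a b : I -> rat) :
    (forall i j, i \in A -> j \in A -> pair (e i) (e j) = if i == j then w i else 0) ->
  pair (\sum_(i in A) a i *: e i) (\sum_(i in A) b i *: e i) =
    \sum_(i in A) a i * (b i * w i).
Proof.
move=> eE.
pose L h : {linear G -> rat | *%R} :=
  HB.pack (pair h) (GRing.isLinear.Build rat G rat *%R (pair h) (pair_lin h)).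
have pair_sum h c : pair h (\sum_(i in A) c i *: e i) =
    \sum_(i in A) c i * pair h (e i).
  rewrite -[LHS]/(L h _) linear_sum; apply: eq_bigr => i _.
  by rewrite linearZ.
rewrite pairC pair_sum; apply: eq_bigr => i iA; congr (_ * _).
rewrite pairC pair_sum (bigD1 i) //= eE // eqxx big1 ?addr0 // => j /andP[jA ne].
by rewrite eE // eq_sym (negPf ne) mulr0.
Qed.

Lemma strict_part N (lam : part N) : lam \in SP N -> strict_seq lam.
Proof.
by rewrite inE => lam_sorted; have /and3P[_ ? _] := partsP lam; apply/andP.
Qed.

Lemma ext_scalars_ppart al : all odd al -> ext_scalars (ppart rat al) = ppart Qts al.
Proof.
elim: al => [|a al IH] /=; first by rewrite /ppart !big_nil rmorph1.
case/andP=> odd_a /IH alE; rewrite /ppart !big_cons rmorphM /=.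
by congr (_ * _); [exact: ext_scalars_psum|exact: alE].
Qed.

Lemma scaler_mul (R : comNzRingType) (A : comAlgType R) (a b : R) (x y : A) :
  (a *: x) * (b *: y) = (a * b) *: (x * y).
Proof. by rewrite -scalerAl -scalerAr scalerA. Qed.

Lemma Tts_ppart al : all odd al -> Tts (ppart Qts al) = rpart al *: ppart Qts al.
Proof.
elim: al => [|a al IH] /=; first by rewrite /ppart /rpart !big_nil rmorph1 scale1r.
case/andP=> odd_a /IH alE; rewrite /ppart /rpart !big_cons rmorphM /=.
transitivity ((rfactor a *: psum Qts a) * (rpart al *: ppart Qts al)).
  by congr (_ * _); [exact: Tts_psum|exact: alE].
exact: scaler_mul.
Qed.

Lemma ext_scalarsZ c g : ext_scalars (c *: g) = ratQts c *: ext_scalars g.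
Proof. by rewrite [LHS]mmapZ mul_malgC. Qed.

Lemma TtsZ c g : Tts (c *: g) = c *: Tts g.
Proof. by rewrite [LHS]mmapZ mul_malgC. Qed.

Theorem theorem3p6 (N : nat)
    (chi : part N -> part N -> rat) (C : part N -> part N -> Qts)
    (chiE : forall lam : part N, lam \in SP N ->
      schurQ lam = \sum_(al in OP N)
        (2 ^+ size al / (zpart al)%:R * chi lam al) *: ppart rat al)
    (CE : forall lam : part N, lam \in SP N ->
      Tts (ext_scalars (schurQ lam)) =
        \sum_(mu in SP N) C lam mu *: ext_scalars (schurQ mu))
    (lam mu : part N) (hlam : lam \in SP N) (hmu : mu \in SP N) :
  C lam mu = 2 ^- size mu * \sum_(al in OP N)
    ratQts (2 ^+ size al / (zpart al)%:R * chi lam al * chi mu al) * rpart al.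
Proof.
pose c nu al : rat := 2 ^+ size (parts al) / (zpart al)%:R * chi nu al.
have orth nu : nu \in SP N -> \sum_(al in OP N) c nu al * chi mu al =
    if nu == mu then 2 ^+ size mu else 0.
  move=> hnu; have <- : gpair (schurQ nu) (schurQ mu) =
      if nu == mu then 2 ^+ size mu else 0.
    rewrite schurQ_orthogonal ?strict_part //.
    by rewrite -[nu == mu]val_eqE /=; case: eqP => // ->.
  rewrite (chiE _ hnu) (chiE _ hmu).
  rewrite (orthogonal_sums gpairC gpair_linear _ _ (@gpair_ppart N)).
  (* The norm z_al / 2^l(al) of p_al cancels one of the two factors 2^l(al) / z_al. *)
  apply: eq_bigr => al _; congr (_ * _).
  have z_neq0 : (zpart al)%:R != 0 :> rat.
    by rewrite pnatr_eq0 -lt0n zpart_gt0 //; have /and3P[] := partsP al.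
  by rewrite /c; field; rewrite z_neq0 expf_neq0.
have extE nu : nu \in SP N -> ext_scalars (schurQ nu) =
    \sum_(al in OP N) ratQts (c nu al) *: ppart Qts al.
  move=> hnu; rewrite (chiE _ hnu) rmorph_sum; apply: eq_bigr => al.
  by rewrite inE => al_odd; rewrite /= ext_scalarsZ ext_scalars_ppart.
(* Both sides are the coefficient of p_al in T Q_lam, computed from the action of T on power sums
   and from [CE]. *)
have key al : al \in OP N -> ratQts (c lam al) * rpart al =
    \sum_(nu in SP N) C lam nu * ratQts (c nu al).
  apply: (@ppart_coef_eq Qts N (fun al => ratQts (c lam al) * rpart al) (C lam)
    (fun nu al => ratQts (c nu al))).
  transitivity (\sum_(nu in SP N) C lam nu *: ext_scalars (schurQ nu)); last first.
    by apply: eq_bigr => nu hnu; congr (_ *: _); exact: extE.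
  apply: etrans (CE lam hlam); symmetry.
  apply: etrans (congr1 Tts (extE lam hlam)) _.
  apply: etrans (rmorph_sum Tts _ _ _) _; apply: eq_bigr => be be_odd.
  apply: etrans (TtsZ _ _) _; rewrite -scalerA; congr (_ *: _).
  by apply: Tts_ppart; move: be_odd; rewrite inE.
exact: (@extract_coef Qts ratQts N (size mu) lam mu
  (fun _ al => 2 ^+ size (parts al) / (zpart al)%:R) chi C rpart hmu orth key).
Qed.
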